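(* Let $\alpha,\gamma\in(0,1]$, $f_0\in C^\alpha[0,1]$ and $x\in(0,1)$. Let $Q_\gamma^*$ be the sparse variational Gaussian process regression posterior (SGPR) with the rescaled Brownian motion prior of regularity $\gamma$ and $m=m_n\to\infty$ eigenvector inducing variables ($m_n\le n$), based on data $\mathcal D_n$. Then for every sequence $M_n\to\infty$ (growing arbitrarily slowly), $$E_{f_0} Q_\gamma^*\Big(f: |f(x)-f_0(x)| > M_n\big( n^{-\frac{\alpha\wedge\gamma}{1+2\gamma}} + n^{\frac{2}{1+2\gamma}}m^{-1-\alpha} + n^{\frac{3/2-\gamma}{1+2\gamma}}m^{-3/2}\big)\,\Big|\,\mathcal D_n\Big)\to 0$$ as $n\to\infty$. If moreover $m_n\gg n^{\frac{1}{1+2\gamma}\left(\frac{2+\alpha}{1+\alpha}\right)}$, then the contraction rate of the SGPR at $x$ matches that of the full posterior, namely $n^{-\frac{\alpha\wedge\gamma}{1+2\gamma}}$: for every $M_n\to\infty$, $$E_{f_0} Q_\gamma^*\Big(f: |f(x)-f_0(x)| > M_n n^{-\frac{\alpha\wedge\gamma}{1+2\gamma}}\,\Big|\,\mathcal D_n\Big)\to 0.$$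
   Context: Model: for each $n$, the design points are fixed, $x_i=\frac{i}{n+1/2}\in[0,1]$, $i=1,\dots,n$, and one observes $\mathcal D_n=\{(x_1,y_1),\dots,(x_n,y_n)\}$ with $y_i=f_0(x_i)+\varepsilon_i$, $\varepsilon_i$ i.i.d. $\mathcal N(0,1)$ (noise variance $\sigma^2=1$). $P_{f_0}$, $E_{f_0}$ denote the law of $\mathbf y=(y_1,\dots,y_n)^T$ and its expectation. $C^\alpha[0,1]=\{f:[0,1]\to\mathbb R: \sup_{s\ne t}|f(s)-f(t)|/|s-t|^\alpha<\infty\}$ for $\alpha\in(0,1]$. $a\wedge b=\min(a,b)$; $a_n\gg b_n$ means $b_n/a_n\to0$. Prior: the rescaled Brownian motion prior of regularity $\gamma$ is the centred Gaussian process on $[0,1]$ with covariance kernel $k(s,t)=c_n\min(s,t)$, $c_n=(n+1/2)^{\frac{1-2\gamma}{1+2\gamma}}$. Full posterior: the Gaussian process with mean $\nu_n(x)=\mathbf k_n(x)^T(\mathbf K_{nn}+\mathbf I_n)^{-1}\mathbf y$ and covariance $k(x,x')-\mathbf k_n(x)^T(\mathbf K_{nn}+\mathbf I_n)^{-1}\mathbf k_n(x')$, where $\mathbf k_n(x)=(k(x,x_1),\dots,k(x,x_n))^T$ and $[\mathbf K_{nn}]_{ij}=k(x_i,x_j)$. SGPR with $m$ eigenvector inducing variables: let $\mu_1\ge\dots\ge\mu_n\ge0$ be the eigenvalues of $\mathbf K_{nn}$ with orthonormal eigenvectors $\mathbf v_1,\dots,\mathbf v_n$, and $\eta_j=1/(1+\mu_j)$.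 The inducing variables are $u_j=\mathbf v_j^T(f(x_1),\dots,f(x_n))^T$, $j\le m$, and the SGPR $Q_\gamma^*=Q_\gamma^*(\cdot\,|\,\mathcal D_n)$ is the Gaussian process with mean and covariance $$\nu_m(x)=\mathbf k_n(x)^T\Big[\sum_{j=1}^m\eta_j\mathbf v_j\mathbf v_j^T\Big]\mathbf y,\qquad k_m(x,x')=k(x,x')-\mathbf k_n(x)^T\Big[\sum_{j=1}^m\eta_j\mathbf v_j\mathbf v_j^T\Big]\mathbf k_n(x').$$ *)

(* Defs.v *)
From HB Require Import structures.
From mathcomp Require Import all_boot all_order all_algebra.
From mathcomp Require Import all_classical all_reals all_analysis.

Set Implicit Arguments.
Unset Strict Implicit.
Unset Printing Implicit Defensive.

Import Order.TTheory GRing.Theory Num.Theory.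
Import numFieldNormedType.Exports.

Local Open Scope classical_set_scope.
Local Open Scope ring_scope.

(* Only the values on [0, 1] of [f : R -> R] matter. *)
Definition holder_class (R : realType) (alpha : R) : set (R -> R) :=
  [set f | exists L : R, forall s t : R,
     0 <= s <= 1 -> 0 <= t <= 1 -> s != t ->
     `|f s - f t| / (`|s - t| `^ alpha) <= L].

(* N(m, v), parametrised by the variance and allowing v = 0; the library's
   [normal_prob] takes the standard deviation, and is not a point mass when
   that is 0. *)
Definition gaussian (R : realType) (m v : R) (B : set R) : \bar R :=
  if v == 0 then \d_m B else normal_prob m (Num.sqrt v) B.

Definition mutually_independent (d : measure_display) (T : measurableType d)
    (R : realType) (P : probability T R) (I : finType)
    (X : I -> {RV P >-> measurableTypeR R}) : Prop :=
  forall (J : {set I}) (B : I -> set (measurableTypeR R)),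
    (forall i, measurable (B i)) ->
    P (\bigcap_(i in [set i | i \in J]) (X i @^-1` B i)) =
    (\prod_(i in J) P (X i @^-1` B i))%E.

Definition iid_std_normal (d : measure_display) (T : measurableType d)
    (R : realType) (P : probability T R) (I : finType)
    (X : I -> {RV P >-> measurableTypeR R}) : Prop :=
  mutually_independent X /\
  forall (i : I) (B : set (measurableTypeR R)), measurable B ->
    distribution P (X i) B = normal_prob 0 1 B.

(* Sample paths on [0, 1], with the cylinder sigma-algebra. Paths are
   represented by functions R -> R; since only the evaluations at points of
   [0, 1] generate, a measurable event depends only on the restriction of the
   path to [0, 1]. *)
Definition cylinders (R : realType) : set (set (R -> R)) :=
  [set A | exists t : R, 0 <= t <= 1 /\
     exists B : set (measurableTypeR R), measurable B /\
       A = [set f : R -> R | B (f t)]].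

Notation path_space R := (g_sigma_algebraType (@cylinders R)).

(* A finite-dimensional law is the multivariate normal one iff each linear
   combination of its coordinates is normal with the matching mean and
   variance. *)
Definition is_gaussian_process (R : realType)
    (Q : probability (path_space R) R) (mu : R -> R) (k : R -> R -> R) : Prop :=
  forall (N : nat) (t a : 'I_N -> R) (B : set (measurableTypeR R)),
    (forall i, 0 <= t i <= 1) -> measurable B ->
    Q [set f : path_space R | B (\sum_(i < N) a i * f (t i))] =
    gaussian (\sum_(i < N) a i * mu (t i))
             (\sum_(i < N) \sum_(j < N) a i * a j * k (t i) (t j)) B.

Section Regression.
Context {R : realType}.
Implicit Types (gamma x : R) (n m : nat).

Definition design n (i : 'I_n) : R := i.+1%:R / (n%:R + 2^-1).

Definition observations (f0 : R -> R) n (e : 'I_n -> R) : 'cV[R]_n :=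
  \col_i (f0 (design i) + e i).

(* covariance kernel of the rescaled Brownian motion prior *)
Definition rbm_kernel gamma n (s t : R) : R :=
  (n%:R + 2^-1) `^ ((1 - 2 * gamma) / (1 + 2 * gamma)) * Num.min s t.

Definition gram (k : R -> R -> R) n : 'M[R]_n :=
  \matrix_(i, j) k (design i) (design j).

Definition kvec (k : R -> R -> R) n x : 'cV[R]_n := \col_i k x (design i).

(* The full posterior and its sparse approximation have this mean and this
   covariance function, for different matrices W. *)
Definition mean_fun (k : R -> R -> R) n (W : 'M[R]_n) (y : 'cV[R]_n) x : R :=
  ((kvec k n x)^T *m W *m y) ord0 ord0.

Definition cov_fun (k : R -> R -> R) n (W : 'M[R]_n) (x x' : R) : R :=
  k x x' - ((kvec k n x)^T *m W *m kvec k n x') ord0 ord0.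

Definition is_full_posterior gamma n (y : 'cV[R]_n)
    (Q : probability (path_space R) R) : Prop :=
  let k := rbm_kernel gamma n in
  let W := invmx (gram k n + 1%:M) in
  is_gaussian_process Q (mean_fun k W y) (cov_fun k W).

Definition ordered_eigenbasis n (K : 'M[R]_n)
    (mu : 'I_n -> R) (v : 'I_n -> 'cV[R]_n) : Prop :=
  [/\ forall j, K *m v j = mu j *: v j,
      forall i j, (v i)^T *m v j = ((i == j)%:R)%:M,
      forall i j : 'I_n, (i <= j)%N -> mu j <= mu i
    & forall j, 0 <= mu j].

Definition eigenvector_weight n m
    (mu : 'I_n -> R) (v : 'I_n -> 'cV[R]_n) : 'M[R]_n :=
  \sum_(j < n | (j < m)%N) (1 + mu j)^-1 *: (v j *m (v j)^T).

(* The SGPR with the m inducing variables (v j)^T (f(x_1), ..., f(x_n))^T,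
   j < m. *)
Definition is_sgpr gamma n m (mu : 'I_n -> R) (v : 'I_n -> 'cV[R]_n)
    (y : 'cV[R]_n) (Q : probability (path_space R) R) : Prop :=
  let k := rbm_kernel gamma n in
  let W := eigenvector_weight m mu v in
  is_gaussian_process Q (mean_fun k W y) (cov_fun k W).

End Regression.

(* The random measure [Q n w] contracts around [f0] at the point [x] at rate
   [r n]. *)
Definition contracts_at (R : realType) (d : nat -> measure_display)
    (Omega : forall n, measurableType (d n))
    (P : forall n, probability (Omega n) R)
    (Q : forall n, Omega n -> probability (path_space R) R)
    (f0 : R -> R) (x : R) (r : nat -> R) : Prop :=
  forall M : nat -> R, M n @[n --> \oo] --> +oo ->
    (\int[P n]_w Q n w [set f : path_space R | (M n * r n < `|f x - f0 x|)%R])%E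
      @[n --> \oo] --> 0%E.

(* Main.v *)
(* By Chebyshev and Markov only second moments matter: the expected posterior
   mass outside the ball of radius t around f0 x is at most a constant times
   (posterior variance + squared bias + variance of the posterior mean) / t^2.

   Write N = n + 1/2, h = N^(1/(1+2 gamma)) and a = c_n / N, so that
   a N^2 = h^2 and the Gram matrix is a * min(i, j).  Its inverse is a discrete
   Laplacian with a Dirichlet condition at 0 and a Neumann condition at n, whose
   eigenvectors are sin(k (j + 1/2) pi / N); hence mu_j <= 4 h^2 / (j + 1)^2, and
   all variance terms are sums of min(1, mu_j) / N or, for the discarded
   eigenvectors, of mu_j / N.  Off the design, kernels and posterior means are
   linear interpolations of their values at the two neighbouring design points.

   The bias of the full posterior mean g is not controlled term by term in the
   eigenbasis.  Instead g solves a (F - g) = - (second difference of g), and the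
   maximum principle with the barrier 3 + a (k - N x)^2 gives a bias
   O(h^(-alpha)).  Truncation at m costs
   sum_(j >= m) mu_j * (j-th sine coefficient of f0), where the coefficients of
   an alpha-Holder function are O(j^(-alpha)), hence h^2 m^(-1-alpha). *)

Require Import Defs.
From HB Require Import structures.
From mathcomp Require Import all_boot all_order all_algebra.
From mathcomp Require Import all_classical all_reals all_analysis.
From mathcomp Require Import measurable_realfun.
From mathcomp Require Import zify ring lra.

Set Implicit Arguments.
Unset Strict Implicit.
Unset Printing Implicit Defensive.

Import Order.TTheory GRing.Theory Num.Theory.
Import numFieldNormedType.Exports.

Local Open Scope classical_set_scope.
Local Open Scope ring_scope.

(** * Second moments of posterior and noise *)

(** The integral of a nonnegative function is the supremum over the simple functions below it, so
    monotonicity holds for arbitrary functions. It is applied to [w => Q w A], whose measurability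
    in [w] is not part of the model. *)
Lemma ge0_integral_mono (d : measure_display) (T : measurableType d)
    (R : realType) (mu : {measure set T -> \bar R}) (f g : T -> \bar R) :
  (forall x, 0 <= f x)%E -> (forall x, f x <= g x)%E ->
  (\int[mu]_x f x <= \int[mu]_x g x)%E.
Proof.
move=> f0 fg; have g0 x : (0 <= g x)%E := le_trans (f0 x) (fg x).
rewrite !ge0_integralTE//; apply: le_ereal_sup => _ [h hf <-].
by exists h => // x; exact: le_trans (hf x) (fg x).
Qed.

Lemma measurable_dist_gt (R : realType) (c t : R) :
  measurable ([set z : R | t < `|z - c|] : set (measurableTypeR R)).
Proof.
rewrite (_ : mkset _ = (fun z => `|z - c|) @^-1` `]t, +oo[%classic); last first.
  by apply/seteqP; split => z /=; rewrite in_itv/= andbT.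
rewrite -[X in measurable X]setTI.
suff : measurable_fun setT (fun z : R => `|z - c|) by apply.
by apply: measurableT_comp => //; exact: measurable_funB.
Qed.

(** Doubling the standard deviation absorbs the quadratic factor: with u = (z - m)^2 / (8 s^2) the
    claim becomes 2 u exp(-4u) <= exp(-u), which follows from 1 + 3u <= exp(3u). Second moments thus
    reduce to the total mass of a normal density, with a factor 8 in place of 1. *)
Lemma normal_pdf_second_moment (R : realType) (m s z : R) : s != 0 ->
  (z - m) ^+ 2 * normal_pdf m s z <= 8 * s ^+ 2 * normal_pdf m (2 * s) z.
Proof.
move=> s0; have s20 : 2 * s != 0 by rewrite mulf_neq0.
have s2gt0 : 0 < s ^+ 2 by rewrite exprn_even_gt0.
rewrite !normal_pdfE// /normal_fun.
have -> : normal_peak s = 2 * normal_peak (2 * s).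
  rewrite /normal_peak.
  have -> : (2 * s) ^+ 2 * pi *+ 2 = 2 ^+ 2 * (s ^+ 2 * pi *+ 2) :> R by ring.
  by rewrite sqrtrM ?sqr_ge0// sqrtr_sqr ger0_norm// invfM mulrA divff// mul1r.
set p := normal_peak _; have p0 : 0 <= p := normal_peak_ge0 _.
set u := (z - m) ^+ 2 / (8 * s ^+ 2).
have u0 : 0 <= u by rewrite divr_ge0 ?sqr_ge0// mulr_ge0// ltW.
have -> : - (z - m) ^+ 2 / (s ^+ 2 *+ 2) = - (4 * u).
  by rewrite /u; field.
have -> : - (z - m) ^+ 2 / ((2 * s) ^+ 2 *+ 2) = - u.
  by rewrite /u; field.
have -> : (z - m) ^+ 2 = 8 * s ^+ 2 * u by rewrite /u; field.
have key : u * (2 * expR (- (4 * u))) <= expR (- u).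
  have -> : - (4 * u) = - u - (3 * u) by ring.
  have := expR_ge1Dx (3 * u); rewrite expRD [expR (- (3 * u))]expRN => h.
  have e3 : 0 < expR (3 * u) := expR_gt0 _.
  have -> : u * (2 * (expR (- u) / expR (3 * u))) =
    expR (- u) * (2 * u / expR (3 * u)) by ring.
  rewrite -[X in _ <= X]mulr1; apply: ler_wpM2l; first exact: expR_ge0.
  by rewrite ler_pdivrMr// mul1r; lra.
have -> : 8 * s ^+ 2 * u * (2 * p * expR (- (4 * u))) =
  8 * s ^+ 2 * p * (u * (2 * expR (- (4 * u)))) by ring.
rewrite [8 * s ^+ 2 * (p * _)]mulrA; apply: ler_wpM2l => //.
by apply: mulr_ge0 => //; apply: mulr_ge0 => //; exact: ltW.
Qed.

Lemma normal_prob_tail (R : realType) (m s t : R) : s != 0 -> 0 < t ->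
  (normal_prob m s [set z : R | (t < `|z - m|)%R] <=
   (8 * s ^+ 2 / t ^+ 2)%:E)%E.
Proof.
move=> s0 t0; have s20 : 2 * s != 0 by rewrite mulf_neq0.
have C0 : 0 <= 8 * s ^+ 2 / t ^+ 2.
  by rewrite divr_ge0 ?sqr_ge0// pmulr_rge0 ?sqr_ge0.
rewrite /normal_prob.
have -> : (8 * s ^+ 2 / t ^+ 2)%:E =
    (\int[lebesgue_measure]_z ((8 * s ^+ 2 / t ^+ 2)%:E * (normal_pdf m (2 * s) z)%:E))%E.
  rewrite ge0_integralZl//=.
  - by rewrite integral_normal_pdf mule1.
  - by apply/measurable_EFinP; exact: measurable_normal_pdf.
  - by move=> z _; rewrite lee_fin normal_pdf_ge0.
rewrite integral_mkcond; apply: ge0_integral_mono => z.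
  by rewrite patchE; case: ifP => // _; rewrite lee_fin normal_pdf_ge0.
rewrite patchE -EFinM; case: ifPn => [|_]; last first.
  by rewrite lee_fin mulr_ge0 ?normal_pdf_ge0.
rewrite inE/= => tz; rewrite lee_fin mulrAC ler_pdivlMr ?exprn_gt0//.
apply: le_trans (normal_pdf_second_moment m z s0).
rewrite mulrC ler_wpM2r ?normal_pdf_ge0// -(real_normK (num_real (z - m))).
by rewrite lerXn2r ?nnegrE ?(ltW t0) ?(ltW tz).
Qed.

(** If [c] is at distance at least t/2 from [m], the right-hand side is at least 1. Otherwise the
    event forces |z - m| > t/2, so Chebyshev around [m] applies at radius t/2, whence 32 = 8 * 4;
    for [v = 0] the point mass at [m] misses the event. *)
Lemma gaussian_tail (R : realType) (m v c t : R) : 0 <= v -> 0 < t ->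
  (gaussian m v [set z : R | (t < `|z - c|)%R] <=
   (32 * (v + (m - c) ^+ 2) / t ^+ 2)%:E)%E.
Proof.
move=> v0 t0; have t20 : 0 < t ^+ 2 by rewrite exprn_gt0.
have [tmc|tmc] := leP t (2 * `|m - c|).
  have : (1 <= (32 * (v + (m - c) ^+ 2) / t ^+ 2)%:E)%E.
    rewrite lee_fin ler_pdivlMr// mul1r.
    have : t ^+ 2 <= (2 * `|m - c|) ^+ 2.
      by rewrite lerXn2r// ?nnegrE ?mulr_ge0// ltW.
    rewrite exprMn real_normK ?num_real//.
    have := sqr_ge0 (m - c); lra.
  apply: le_trans; rewrite /gaussian; case: ifP => _.
    by rewrite diracE lee_fin; case: (_ \in _).
  by apply: probability_le1; exact: measurable_dist_gt.
have rhs0 : (0 <= (32 * (v + (m - c) ^+ 2) / t ^+ 2)%:E)%E.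
  by rewrite lee_fin divr_ge0 ?(ltW t20)// mulr_ge0// addr_ge0// sqr_ge0.
rewrite /gaussian; case: ifPn => [_|v1].
  rewrite diracE memNset//=; apply/negP; rewrite -leNgt.
  by apply: le_trans (ltW tmc); rewrite ler_peMl//; lra.
have vgt0 : 0 < v by rewrite lt_neqAle eq_sym v1.
have s0 : Num.sqrt v != 0 by rewrite gt_eqF// sqrtr_gt0.
have t2 : 0 < t / 2 by rewrite divr_gt0.
apply: (@le_trans _ _ (normal_prob m (Num.sqrt v) [set z : R | (t / 2 < `|z - m|)%R])).
  apply: le_measure; rewrite ?inE.
  - exact: measurable_dist_gt.
  - exact: measurable_dist_gt.
  - move=> z /= tz; have := ler_distD m z c; lra.
apply: (le_trans (normal_prob_tail m s0 t2)).
rewrite lee_fin sqr_sqrtr// expr_div_n invf_div -mulrA (mulrA v).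
rewrite mulrA ler_wpM2r ?invr_ge0 ?(ltW t20)//.
have := sqr_ge0 (m - c); lra.
Qed.

Lemma normal_prob_second_moment (R : realType) :
  (\int[normal_prob 0 1]_(y in [set: measurableTypeR R]) (y ^+ 2)%:E <= 8%:E)%E.
Proof.
have dom := @normal_prob_dominates R 0 1.
have msq : measurable_fun [set: measurableTypeR R] (fun y : R => (y ^+ 2)%:E).
  by apply/measurable_EFinP; exact: measurable_funX.
rewrite -(Radon_Nikodym_SigmaFinite.change_of_variables dom)//; last first.
  by move=> y; rewrite lee_fin sqr_ge0.
have <- : (\int[lebesgue_measure]_z (8%:E * (normal_pdf 0 2 z)%:E) = 8%:E :> \bar R)%E.
  rewrite ge0_integralZl//= ?integral_normal_pdf ?mule1//.
  - by apply/measurable_EFinP; exact: measurable_normal_pdf.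
  - by move=> z _; rewrite lee_fin normal_pdf_ge0.
have intf := Radon_Nikodym_SigmaFinite.f_integrable dom.
have mf := measurable_int _ intf.
have mpdf : measurable_fun [set: measurableTypeR R] (fun y : R => (normal_pdf 0 1 y)%:E).
  by apply/measurable_EFinP; exact: measurable_normal_pdf.
apply: (@le_trans _ _ (\int[lebesgue_measure]_y ((y ^+ 2)%:E * (normal_pdf 0 1 y)%:E))%E).
  rewrite le_eqVlt; apply/orP; left; apply/eqP; apply: ae_eq_integral.
  - exact: measurableT.
  - exact: emeasurable_funM.
  - exact: emeasurable_funM.
  (* The Radon-Nikodym derivative is determined up to null sets; it agrees with the density because
     both have the same integral over every measurable set. *)
  - apply: ae_eqe_mul2l; apply: integral_ae_eq => // E _ mE.
    by rewrite -Radon_Nikodym_SigmaFinite.f_integral.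
apply: ge0_integral_mono => y.
  by rewrite -EFinM lee_fin mulr_ge0 ?sqr_ge0// normal_pdf_ge0.
rewrite -!EFinM lee_fin.
have := @normal_pdf_second_moment R 0 1 y (oner_neq0 _).
by rewrite subr0 expr1n !mulr1.
Qed.

Lemma normal_probN (R : realType) (A : set (measurableTypeR R)) : measurable A ->
  normal_prob 0 1 (-%R @^-1` A) = normal_prob 0 1 A :> \bar R.
Proof.
move=> mA; rewrite /normal_prob.
transitivity (\int[lebesgue_measure]_(x in
   (-%R : measurableTypeR R -> measurableTypeR R) @^-1` A)
    ((fun x => (normal_pdf 0 1 x)%:E) \o -%R) x)%E.
  apply: eq_integral => x _ /=; congr EFin.
  by rewrite !normal_pdfE ?oner_neq0// /normal_fun !subr0 sqrrN.
rewrite -ge0_integral_pushforward//.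
- by apply: eq_measure_integral => B mB _; exact: lebesgue_measureN.
- by apply/measurable_EFinP/measurable_funTS; exact: measurable_normal_pdf.
- by move=> x _; rewrite lee_fin normal_pdf_ge0.
Qed.

(** * Second moments of linear forms in the noise *)

Section iid_moments.
Context (d : measure_display) (T : measurableType d) (R : realType)
  (P : probability T R) (I : finType)
  (X : I -> {RV P >-> measurableTypeR R}).
Hypothesis iidX : iid_std_normal X.

Let mX i : measurable_fun setT (fun w => X i w : R).
Proof. exact: (@measurable_funPT _ _ _ _ (X i)). Qed.

Lemma iid_second_moment i : (\int[P]_w (X i w ^+ 2)%:E <= 8%:E)%E.
Proof.
apply: le_trans (normal_prob_second_moment R).
have msq : measurable_fun [set: measurableTypeR R] (fun y : R => (y ^+ 2)%:E).
  by apply/measurable_EFinP; exact: measurable_funX.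
rewrite -(@ge0_integral_distribution _ _ _ _ _ P (X i) (fun y : R => (y ^+ 2)%:E))//.
  rewrite (eq_measure_integral (normal_prob 0 1))// => A mA _.
  exact: iidX.2.
by move=> y; rewrite lee_fin sqr_ge0.
Qed.

Lemma iid_integrable_sqr i : P.-integrable setT (fun w => (X i w ^+ 2)%:E).
Proof.
apply/integrableP; split.
  by apply/measurable_EFinP; apply: measurable_funX; exact: mX.
apply: (@le_lt_trans _ _ 8%:E); last exact: ltry.
apply: le_trans (iid_second_moment i).
by under eq_integral do rewrite gee0_abs ?lee_fin ?sqr_ge0//.
Qed.

Lemma iid_integrable_mul i j :
  P.-integrable setT (fun w => (X i w * X j w)%:E).
Proof.
apply: (@le_integrable _ _ _ P setT measurableT _
  (fun w => (X i w ^+ 2)%:E + (X j w ^+ 2)%:E)%E).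
- by apply/measurable_EFinP; apply: measurable_funM; exact: mX.
- move=> w _; rewrite -EFinD /= lee_fin [leRHS]ger0_norm ?addr_ge0 ?sqr_ge0//.
  have := sqr_ge0 (`|X i w| - `|X j w|); rewrite sqrrB !real_normK ?num_real// normrM.
  have := sqr_ge0 (X i w); have := sqr_ge0 (X j w); lra.
- by apply: integrableD => //; exact: iid_integrable_sqr.
Qed.

Lemma iid_pair i j (A B : set (measurableTypeR R)) : i != j ->
  measurable A -> measurable B ->
  (P (X i @^-1` A `&` X j @^-1` B) = normal_prob 0 1 A * normal_prob 0 1 B)%E.
Proof.
move=> ij mA mB; have ji : j != i by rewrite eq_sym.
pose C k : set (measurableTypeR R) := if k == i then A else B.
have mC k : measurable (C k) by rewrite /C; case: ifP.
have := iidX.1 [set i; j]%SET C mC.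
rewrite big_setU1 ?inE//= big_set1.
have dX k : P (X k @^-1` C k) = normal_prob 0 1 (C k).
  exact: (iidX.2 k (C k) (mC k)).
rewrite !dX {2 3}/C eqxx (negbTE ji) => <-; congr (P _).
apply/seteqP; split => w /=.
  by move=> [Aw Bw] k; rewrite /= !inE => /orP[]/eqP ->; rewrite /C ?eqxx ?(negbTE ji).
move=> h; split.
  by have := h i; rewrite /= !inE eqxx /C eqxx; apply.
by have := h j; rewrite /= !inE eqxx orbT /C (negbTE ji); apply.
Qed.

(* The pairs (X i, X j) and (X i, - X j) have the same law. *)
Lemma iid_uncorrelated i j : i != j -> (\int[P]_w (X i w * X j w)%:E = 0)%E.
Proof.
move=> ij.
pose g (s : R) w : measurableTypeR R * measurableTypeR R := (X i w, s * X j w).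
have mg s : measurable_fun setT (g s).
  by apply: measurable_fun_pair => //=; exact: measurable_funM.
pose gmix s := isMeasurableFun.Build _ _ _ _ _ (mg s).
pose G s : {mfun T >-> (measurableTypeR R * measurableTypeR R)%type} :=
  HB.pack (g s) (gmix s).
pose f (z : measurableTypeR R * measurableTypeR R) : \bar R := ((z.1 + z.2) ^+ 2)%:E.
have mf : measurable_fun setT f.
  by apply/measurable_EFinP; apply: measurable_funX; exact: measurable_funD.
have law s B : s = 1 \/ s = -1 -> measurable B ->
    distribution P (G s) B = (normal_prob 0 1 \x normal_prob 0 1)%E B.
  move=> s1 mB; apply/esym.
  have U := @product_measure_unique _ _ (measurableTypeR R) (measurableTypeR R)
    R (normal_prob 0 1) (normal_prob 0 1) (distribution P (G s)).
  apply: U => // A A' mA mA'.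
  rewrite /distribution /pushforward /=; case: s1 => ->.
    rewrite -(iid_pair ij)//; congr (P _).
    by apply/seteqP; split => w /=; rewrite /g/= mul1r.
  rewrite -(normal_probN mA') -(iid_pair ij)//.
    congr (P _).
    by apply/seteqP; split => w /=; rewrite /g/= mulN1r.
  have : measurable_fun setT (-%R : measurableTypeR R -> measurableTypeR R) by [].
  by move=> /(_ measurableT _ mA'); rewrite setTI.
have E s : s = 1 \/ s = -1 -> (\int[P]_w ((X i w + s * X j w) ^+ 2)%:E =
    \int[(normal_prob 0 1 \x normal_prob 0 1)%E]_z f z)%E.
  move=> s1; transitivity (\int[distribution P (G s)]_z f z)%E.
    by rewrite ge0_integral_distribution//= => z; rewrite lee_fin sqr_ge0.
  by apply: eq_measure_integral => A mA _; exact: law.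
have D s : (\int[P]_w ((X i w + s * X j w) ^+ 2)%:E =
   \int[P]_w (X i w ^+ 2)%:E + (2 * s)%:E * \int[P]_w (X i w * X j w)%:E
   + (s ^+ 2)%:E * \int[P]_w (X j w ^+ 2)%:E)%E.
  have i1 := iid_integrable_sqr i; have i2 := iid_integrable_mul i j.
  have i3 := iid_integrable_sqr j.
  rewrite -integralZl// -integralZl// -!integralD//.
  - by apply: eq_integral => w _; rewrite -!EFinM -!EFinD; congr EFin; ring.
  - apply: integrableD => //; exact: integrableZl.
  - exact: integrableZl.
  - exact: integrableZl.
(* Both expansions equal the same integral against the product law, and all terms are finite:
   subtracting the case [s = -1] from [s = 1] leaves four times the mixed moment equal to 0. *)
have := E 1 (or_introl erefl); have := E (-1) (or_intror erefl).
rewrite !D => <-.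
have f1 := integrable_fin_num measurableT (iid_integrable_sqr i).
have f2 := integrable_fin_num measurableT (iid_integrable_mul i j).
have f3 := integrable_fin_num measurableT (iid_integrable_sqr j).
rewrite -(fineK f1) -(fineK f2) -(fineK f3) -!EFinM -!EFinD.
by move=> [h]; congr EFin; lra.
Qed.

Lemma iid_linear_second_moment (b : I -> R) :
  (\int[P]_w ((\sum_i b i * X i w) ^+ 2)%:E <= (8 * \sum_i b i ^+ 2)%:E)%E.
Proof.
rewrite (eq_integral (fun w => \sum_i \sum_j (b i * b j)%:E * (X i w * X j w)%:E)%E); last first.
  move=> w _; rewrite expr2 big_distrlr/= -sumEFin; apply: eq_bigr => i _.
  by rewrite -sumEFin; apply: eq_bigr => j _; rewrite -EFinM; congr EFin; ring.
have int2 i j : P.-integrable setT (fun w => (b i * b j)%:E * (X i w * X j w)%:E)%E.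
  by apply: integrableZl => //; exact: iid_integrable_mul.
rewrite integral_sum//; last by move=> i; exact: integrable_sum.
rewrite mulr_sumr -sumEFin; apply: lee_sum => i _.
rewrite integral_sum// (bigD1 i)//= [X in (_ + X)%E]big1; last first.
  move=> j ji; rewrite integralZl//; last exact: iid_integrable_mul.
  by rewrite iid_uncorrelated ?mule0// eq_sym.
rewrite adde0 integralZl//; last exact: iid_integrable_mul.
rewrite -expr2 [8 * _]mulrC [(_ * 8)%:E]EFinM; apply: lee_wpmul2l; first by rewrite lee_fin sqr_ge0.
by under eq_integral do rewrite -expr2; exact: iid_second_moment.
Qed.

End iid_moments.

(** * Posterior mass outside a ball around the true value *)

Lemma gaussian_process_tail (R : realType) (Q : probability (path_space R) R)
    (mu : R -> R) (k : R -> R -> R) (x c t : R) :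
  is_gaussian_process Q mu k -> 0 <= x <= 1 -> 0 <= k x x -> 0 < t ->
  (Q [set f : path_space R | (t < `|f x - c|)%R] <=
   (32 * (k x x + (mu x - c) ^+ 2) / t ^+ 2)%:E)%E.
Proof.
move=> gp x01 k0 t0.
have := gp 1%N (fun=> x) (fun=> 1) [set z | t < `|z - c|] (fun=> x01)
  (@measurable_dist_gt R c t).
rewrite !big_ord1 !mul1r => E.
have -> : [set f : path_space R | t < `|f x - c|] =
    [set f | [set z | t < `|z - c|] (\sum_(i < 1) 1 * f x)].
  by apply/seteqP; split => f /=; rewrite big_ord1 mul1r.
by rewrite E; exact: gaussian_tail.
Qed.

(** The posterior mean misses [f0 x] by a deterministic bias [b] plus a linear form [Z] in the
    noise. The constants 2 and 16 come from (b + Z)^2 <= 2 b^2 + 2 Z^2 and from the factor 8 in the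
    second moment of [Z]; the posterior variance does not depend on the data. *)
Lemma expected_posterior_tail (d : measure_display) (T : measurableType d)
    (R : realType) (P : probability T R) (n : nat)
    (eps : 'I_n -> {RV P >-> measurableTypeR R}) (k : R -> R -> R)
    (W : 'M[R]_n) (f0 : R -> R) (Q : T -> probability (path_space R) R)
    (x t : R) :
  iid_std_normal eps ->
  (forall w, is_gaussian_process (Q w)
     (mean_fun k W (observations f0 (fun i => eps i w))) (cov_fun k W)) ->
  0 <= x <= 1 -> 0 <= cov_fun k W x x -> 0 < t ->
  (\int[P]_w Q w [set f : path_space R | (t < `|f x - f0 x|)%R] <=
   (32 * (cov_fun k W x x
     + 2 * (mean_fun k W (observations f0 (fun=> 0)) x - f0 x) ^+ 2
     + 16 * \sum_i (((kvec k n x)^T *m W) 0 i) ^+ 2) / t ^+ 2)%:E)%E.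
Proof.
move=> iid gp x01 V0 t0.
set V := cov_fun k W x x; set b := mean_fun k W _ x - f0 x.
pose beta i := ((kvec k n x)^T *m W) 0 i.
pose Z w := \sum_i beta i * eps i w.
have meanE w : mean_fun k W (observations f0 (fun i => eps i w)) x - f0 x = b + Z w.
  rewrite /b /mean_fun /Z !mxE addrAC -big_split/=; congr (_ - _).
  have obsE e i : observations f0 e i ord0 = f0 (design i) + e i by rewrite mxE.
  by apply: eq_bigr => i _; rewrite !obsE addr0 mulrDr.
have mZ : measurable_fun setT Z.
  apply: measurable_sum => i; apply: measurable_funM => //.
  exact: (@measurable_funPT _ _ _ _ (eps i)).
have mZ2 : measurable_fun setT (fun w => (Z w ^+ 2)%:E).
  by apply/measurable_EFinP; exact: measurable_funX.
pose C := 32 / t ^+ 2.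
have C0 : 0 <= C by rewrite divr_ge0 ?sqr_ge0.
apply: (@le_trans _ _ (\int[P]_w ((C * (V + 2 * b ^+ 2))%:E + (C * 2)%:E * (Z w ^+ 2)%:E))%E).
  apply: ge0_integral_mono => w; first exact: measure_ge0.
  apply: le_trans (gaussian_process_tail (f0 x) (gp w) x01 V0 t0) _.
  rewrite meanE -EFinM -EFinD lee_fin -mulrA mulrCA -/C mulrC.
  rewrite -/V [leRHS](_ : _ = C * (V + 2 * b ^+ 2 + 2 * Z w ^+ 2)); last by ring.
  rewrite -subr_ge0 [leRHS](_ : _ = C * (b - Z w) ^+ 2); last by ring.
  by rewrite mulr_ge0// sqr_ge0.
have CVb : 0 <= C * (V + 2 * b ^+ 2).
  by rewrite mulr_ge0// addr_ge0// pmulr_rge0 ?sqr_ge0.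
rewrite ge0_integralD//; last 2 first.
- by move=> w _; rewrite -EFinM lee_fin mulr_ge0 ?sqr_ge0// mulr_ge0.
- by apply: emeasurable_funM.
rewrite integral_cst// [X in (_ * X)%E](_ : _ = 1%E) ?mule1; last exact: probability_setT.
rewrite ge0_integralZl//; last 2 first.
- by move=> w _; rewrite lee_fin sqr_ge0.
- by rewrite lee_fin mulr_ge0.
apply: (@le_trans _ _
    ((C * (V + 2 * b ^+ 2))%:E + (C * 2)%:E * (8 * \sum_i beta i ^+ 2)%:E)%E).
  rewrite leeD2l// lee_wpmul2l//; first by rewrite lee_fin mulr_ge0.
  exact: iid_linear_second_moment.
rewrite -EFinM -EFinD lee_fin le_eqVlt; apply/orP; left; apply/eqP.
by rewrite /C; ring.
Qed.

(** * The discrete sine basis *)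

(** With u = t/2, sin t = 2 sin u cos u >= 2 u cos^2 u by the mean value theorem, and cos^2 u >= 1/2
    because cos t >= 0. *)
Lemma sin_ge_half (R : realType) (t : R) : 0 <= t <= pi / 2 -> t / 2 <= sin t.
Proof.
move=> /andP[t0 tpi]; have pi0 := pi_gt0 R.
set u := t / 2; have u0 : 0 <= u by rewrite divr_ge0.
have tu : t = u *+ 2 by rewrite /u; field.
have sinu : u * cos u <= sin u.
  have [->|un0] := eqVneq u 0; first by rewrite mul0r sin0.
  have up : 0 < u by rewrite lt_neqAle eq_sym un0.
  have [|xi] := @MVT R sin cos 0 u up.
    by apply: continuous_subspaceT => z; exact: continuous_sin.
  rewrite in_itv/= => /andP[xi0 xiu]; rewrite sin0 !subr0 => ->.
  rewrite mulrC ler_wpM2r// ltW// ltr_cos// in_itv/= ?u0 ?(ltW xi0)/=; rewrite /u; lra.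
rewrite [in leRHS]tu sin_mulr2n.
have cu0 : 0 <= cos t by apply: cos_ge0_pihalf; lra.
have c2 : 1 / 2 <= cos u ^+ 2.
  by move: cu0; rewrite [in X in X -> _]tu cos_mulr2n; lra.
have cu : 0 <= cos u by apply: cos_ge0_pihalf; rewrite /u; lra.
have : cos u * (u * cos u) <= cos u * sin u by apply: ler_wpM2l.
rewrite mulrCA -expr2 => h; have := ler_wpM2l u0 c2; rewrite -mulr_natl; lra.
Qed.

Section sine_basis.
Context (R : realType) (n : nat).

Let N : R := n%:R + 2^-1.
Let N_gt0 : 0 < N. Proof. by rewrite /N ltr_wpDl. Qed.

(* Chosen so that [sin (k * freq j)], which vanishes at [k = 0], takes equal
   values at [k = n] and [k = n + 1]. *)
Definition freq (j : nat) : R := (j%:R + 2^-1) * pi / (n%:R + 2^-1).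

Definition laplace_eig (j : nat) : R := 2 - 2 * cos (freq j).

Lemma freq_gt0 j : 0 < freq j.
Proof. by rewrite divr_gt0// mulr_gt0 ?pi_gt0// ltr_wpDl. Qed.

Lemma freq_lt_pi j : (j < n)%N -> freq j < pi.
Proof.
move=> jn; rewrite /freq ltr_pdivrMr// mulrC ltr_pM2l ?pi_gt0//.
by rewrite ltrD2r ltr_nat.
Qed.

Lemma sin_half_freq_ge j : (j < n)%N ->
  j.+1%:R / (4 * N) <= sin (freq j / 2).
Proof.
move=> jn; have f0 := freq_gt0 j; have fpi := freq_lt_pi jn.
apply: le_trans (sin_ge_half _); last by lra.
rewrite ler_pdivrMr ?mulr_gt0//.
have -> : freq j / 2 / 2 * (4 * N) = (j%:R + 2^-1) * pi.
  by rewrite /freq -/N; field; rewrite gt_eqF.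
have j0 : 0 <= j%:R :> R by [].
(* The bound pi >= 2 suffices: (j + 1/2) * 2 = 2j + 1 >= j + 1. *)
rewrite -natr1; have := @pi_ge2 R.
have /ler_wpM2l h : 0 <= j%:R + 2^-1 :> R by lra.
by move=> /h; lra.
Qed.

Lemma laplace_eigE j : laplace_eig j = 4 * sin (freq j / 2) ^+ 2.
Proof.
rewrite /laplace_eig [in LHS](_ : freq j = (freq j / 2) *+ 2); last by field.
by rewrite cos_mulr2n cos2sin2 -mulr_natl; ring.
Qed.

Lemma laplace_eig_ge j : (j < n)%N ->
  j.+1%:R ^+ 2 / (4 * N ^+ 2) <= laplace_eig j.
Proof.
move=> jn; rewrite laplace_eigE.
have low0 : 0 <= j.+1%:R / (4 * N) by rewrite divr_ge0// mulr_ge0// ltW.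
have : (j.+1%:R / (4 * N)) ^+ 2 <= sin (freq j / 2) ^+ 2.
  rewrite lerXn2r// ?nnegrE//; last exact: sin_half_freq_ge.
  exact: le_trans low0 (sin_half_freq_ge jn).
rewrite expr_div_n => h.
rewrite (_ : _ / _ = 4 * (j.+1%:R ^+ 2 / (4 * N) ^+ 2)); first by rewrite ler_pM2l.
by field; rewrite gt_eqF.
Qed.

Lemma laplace_eig_gt0 j : (j < n)%N -> 0 < laplace_eig j.
Proof.
move=> jn; apply: lt_le_trans (laplace_eig_ge jn).
by rewrite divr_gt0// ?mulr_gt0// exprn_gt0.
Qed.

Lemma laplace_eig_lt i j : (i < j)%N -> (j < n)%N ->
  laplace_eig i < laplace_eig j.
Proof.
move=> ij jn; rewrite /laplace_eig ltrD2l ltrN2 ltr_pM2l// ltr_cos.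
- by rewrite /freq ltr_pM2r ?invr_gt0// ltr_pM2r ?pi_gt0// ltrD2r ltr_nat.
- by rewrite in_itv/= !ltW ?freq_gt0 ?freq_lt_pi// (ltn_trans ij).
- by rewrite in_itv/= !ltW ?freq_gt0 ?freq_lt_pi.
Qed.

Lemma sine_recurrence j k :
  2 * sin (k.+1%:R * freq j) - sin (k%:R * freq j) - sin (k.+2%:R * freq j)
  = laplace_eig j * sin (k.+1%:R * freq j).
Proof.
have -> : k%:R * freq j = k.+1%:R * freq j - freq j by rewrite -natr1; ring.
have -> : k.+2%:R * freq j = k.+1%:R * freq j + freq j by rewrite -[in LHS]natr1; ring.
by rewrite sinB sinD /laplace_eig; ring.
Qed.

Lemma sin_odd_pi j : sin ((2 * j%:R + 1) * pi) = 0 :> R.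
Proof.
elim: j => [|j IH]; first by rewrite mulr0 add0r mul1r sinpi.
have -> : (2 * j.+1%:R + 1) * pi = (2 * j%:R + 1) * pi + pi *+ 2 :> R.
  by rewrite -natr1 -mulr_natl; ring.
by rewrite sinD2pi.
Qed.

Lemma cos_odd_pi j : cos ((2 * j%:R + 1) * pi) = -1 :> R.
Proof.
elim: j => [|j IH]; first by rewrite mulr0 add0r mul1r cospi.
have -> : (2 * j.+1%:R + 1) * pi = (2 * j%:R + 1) * pi + pi *+ 2 :> R.
  by rewrite -natr1 -mulr_natl; ring.
by rewrite cosD2pi.
Qed.

Lemma freq_period j : (2 * n%:R + 1) * freq j = (2 * j%:R + 1) * pi.
Proof. by rewrite /freq -/N /N; field; rewrite gt_eqF// ltr_wpDl. Qed.

(** The two arguments add up to (2n + 1) [freq j], an odd multiple of pi, and the sine is symmetric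
    about half of such a multiple. *)
Lemma sine_neumann j : sin (n.+1%:R * freq j) = sin (n%:R * freq j).
Proof.
have -> : n.+1%:R * freq j = (2 * n%:R + 1) * freq j - n%:R * freq j.
  by rewrite -natr1; ring.
by rewrite freq_period sinB sin_odd_pi cos_odd_pi; ring.
Qed.

(** Multiplied by 4 sin([freq j]), the partial sums telescope to a linear term minus sin((2k + 1)
    [freq j]), and the latter vanishes at k = n. *)
Lemma sine_norm j : (j < n)%N ->
  \sum_(i < n) sin (i.+1%:R * freq j) ^+ 2 = N / 2.
Proof.
move=> jn; have f0 := freq_gt0 j; have fpi := freq_lt_pi jn.
have s0 : sin (freq j) != 0 by rewrite gt_eqF// sin_gt0_pi// f0.
have tel k : 4 * sin (freq j) * \sum_(i < k) sin (i.+1%:R * freq j) ^+ 2 =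
    (2 * k%:R + 1) * sin (freq j) - sin ((2 * k%:R + 1) * freq j).
  elim: k => [|k IH]; first by rewrite big_ord0; rewrite !mulr0 add0r !mul1r subrr.
  rewrite big_ord_recr/= mulrDr IH.
  set a := k.+1%:R * freq j.
  have -> : (2 * k%:R + 1) * freq j = a *+ 2 - freq j by rewrite /a -natr1 -mulr_natl; ring.
  have -> : (2 * k.+1%:R + 1) * freq j = a *+ 2 + freq j by rewrite /a -natr1 -mulr_natl; ring.
  rewrite sinB (sinD (a *+ 2)) cos_mulr2n (_ : k.+1%:R = k%:R + 1 :> R) ?natr1// (sin2cos2 a).
  ring.
apply: (mulfI (_ : 4 * sin (freq j) != 0)); first by rewrite mulf_neq0.
by rewrite tel freq_period sin_odd_pi /N; field.
Qed.

(** Multiplied by 2 sin([freq j] / 2), the sum telescopes to a difference of two cosines, hence is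
    at most 2 in absolute value, whatever [k] is. *)
Lemma sine_partial_sum j k : (j < n)%N ->
  `|\sum_(i < k) sin (i.+1%:R * freq j)| <= 4 * N / j.+1%:R.
Proof.
move=> jn; set h := freq j / 2.
have hlow := sin_half_freq_ge jn; rewrite -/h in hlow.
have low0 : 0 < j.+1%:R / (4 * N) by rewrite divr_gt0// mulr_gt0.
have sh : 0 < sin h by apply: lt_le_trans hlow.
have tel : 2 * sin h * \sum_(i < k) sin (i.+1%:R * freq j) =
    cos h - cos ((2 * k%:R + 1) * h).
  elim: k => [|k IH]; first by rewrite big_ord0 !mulr0 add0r mul1r subrr.
  rewrite big_ord_recr/= mulrDr IH.
  set a := k.+1%:R * freq j.
  have -> : (2 * k%:R + 1) * h = a - h by rewrite /a /h -natr1; field.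
  have -> : (2 * k.+1%:R + 1) * h = a + h by rewrite /a /h -natr1; field.
  by rewrite cosB cosD; ring.
have : `|2 * sin h * \sum_(i < k) sin (i.+1%:R * freq j)| <= 2.
  rewrite tel (le_trans (ler_normB _ _))//.
  by have := cos_max h; have := cos_max ((2 * k%:R + 1) * h); lra.
rewrite normrM ger0_norm ?mulr_ge0 ?(ltW sh)//.
set S := `|_|; have S0 : 0 <= S by rewrite /S.
move=> h1; have h2 := ler_wpM2r S0 hlow.
have : j.+1%:R / (4 * N) * S <= 1 by lra.
by rewrite ler_pdivlMr// mulrAC ler_pdivrMr ?mulr_gt0// mul1r mulrC.
Qed.

End sine_basis.

(** * Discrete Laplacian and oscillating sums *)

(** Induction on [i]: passing from [i] to [i + 1] adds 1 to the kernel exactly at the indices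
    [j >= i], and the second differences over these telescope to [s i.+1 - s i] thanks to the
    Neumann condition at [n]. *)
Lemma min_kernel_inverse (R : comNzRingType) (n : nat) (s : nat -> R) (i : nat) :
  s 0%N = 0 -> s n.+1 = s n -> (i <= n)%N ->
  \sum_(j < n) (minn i j.+1)%:R * (2 * s j.+1 - s j - s j.+2) = s i.
Proof.
move=> s0 sn; elim: i => [|i IH] ilen.
  by rewrite s0 big1// => j _; rewrite min0n mul0r.
rewrite (eq_bigr (fun j : 'I_n => (minn i j.+1)%:R * (2 * s j.+1 - s j - s j.+2)
    + (i <= j)%N%:R * (2 * s j.+1 - s j - s j.+2))); last first.
  move=> j _; rewrite -mulrDl -natrD; congr (_%:R * _); lia.
rewrite big_split/= IH; last exact: ltnW.
rewrite -(big_mkord xpredT (fun j => (i <= j)%N%:R * (2 * s j.+1 - s j - s j.+2))).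
rewrite (big_cat_nat (n := i))//=; last exact: ltnW.
rewrite [X in _ + (X + _) = _]big_nat_cond big1 ?add0r; last first.
  by move=> j /andP[/andP[_ ji] _]; rewrite leqNgt ji mul0r.
pose D j := s j - s j.+1.
rewrite (@eq_big_nat _ _ _ _ _ _ (fun j => D j.+1 - D j)); last first.
  move=> j /andP[ij _]; rewrite ij mul1r /D mulr_natl mulr2n opprB addrACA.
  by rewrite -!addrA [in RHS](addrC (- _)).
by rewrite telescope_sumr ?(ltnW ilen)// /D sn subrr sub0r opprB addrC subrK.
Qed.

(** The inverse relation: as a function of [i], min(i, j + 1) is linear except for a kink at j + 1,
    so only the term [j = k] survives. *)
Lemma min_kernel_laplacian (R : comNzRingType) (n : nat) (z : 'I_n -> R) (k : 'I_n) :
  let G i := \sum_(j < n) (minn i j.+1)%:R * z j in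
  2 * G k.+1 - G k - G k.+2 = z k.
Proof.
move=> G; rewrite /G mulr_sumr -!sumrB (bigD1 k)//= big1 => [|j jk].
  rewrite addr0 minnn !mulrA -!mulrBl.
  have -> : minn k k.+1 = k by lia.
  have -> : minn k.+2 k.+1 = k.+1 by lia.
  by rewrite -natr1; ring.
have {}jk : (j != k :> nat) by [].
rewrite !mulrA -!mulrBl -natrM -natrB; last by lia.
rewrite -natrB; last by lia.
by rewrite (_ : (_ - _ - _)%N = 0%N) ?mul0r//; lia.
Qed.

(** A negative minimum cannot sit at 0. At any other index both neighbours are at least as large (at
    [n] the right one by the boundary assumption), so the second-difference part is at most 0 while
    [a * u] is negative, against the difference inequality. *)
Lemma discrete_min_principle (R : realDomainType) (n : nat) (a : R) (u : nat -> R) :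
  0 < a -> 0 <= u 0%N -> u n <= u n.+1 ->
  (forall k, (k < n)%N -> 0 <= a * u k.+1 + (2 * u k.+1 - u k - u k.+2)) ->
  forall k, (k <= n)%N -> 0 <= u k.
Proof.
move=> a0 u0 un hu k kn.
pose i0 : 'I_n.+1 := [arg min_(i < ord0) u i]%O.
have imin (j : nat) : (j <= n)%N -> u i0 <= u j.
  rewrite -ltnS /i0 => jn; case: arg_minP => // i _ /(_ (Ordinal jn)); exact.
apply: le_trans (imin k kn); rewrite leNgt; apply/negP.
case: i0 imin => [[|i] /= ilt] imin; first by rewrite ltNge u0.
move=> ui; have := hu i ilt; rewrite leNgt => /negP; apply.
have h1 := imin i (ltnW ilt).
have h2 : u i.+1 <= u i.+2.
  have [->//|ne] := eqVneq i.+1 n.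
  by apply: imin; rewrite ltn_neqAle ne.
have h3 : a * u i.+1 < 0 by rewrite pmulr_rlt0.
by lra.
Qed.

(* The quadratic [B * (3 + a * (k - xi) ^+ 2)] is a supersolution for the
   difference equation [a * u - u'' = a * (F - c)] solved by [G - c]. *)
Lemma min_kernel_barrier (R : realFieldType) (n : nat) (a B c xi : R)
    (F : 'I_n -> R) (G : nat -> R) :
  0 < a -> 0 <= B -> xi <= n%:R ->
  (forall k, G k = a * \sum_(j < n) (minn k j.+1)%:R * (F j - G j.+1)) ->
  (forall k : 'I_n, `|F k - c| <= B * (1 + a * (k.+1%:R - xi) ^+ 2)) ->
  `|c| <= B * (a * xi ^+ 2) ->
  forall k, (k <= n)%N -> `|G k - c| <= B * (3 + a * (k%:R - xi) ^+ 2).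
Proof.
move=> a0 B0 xin GE Fc c0 k kn.
pose phi (k : nat) : R := B * (3 + a * (k%:R - xi) ^+ 2).
have G0 : G 0%N = 0.
  by rewrite GE big1 ?mulr0// => j _; rewrite min0n mul0r.
have Gn : G n.+1 = G n.
  rewrite GE [RHS]GE; congr (_ * _); apply: eq_bigr => j _; congr (_%:R * _).
  by have := ltn_ord j; lia.
have GL (j : 'I_n) : 2 * G j.+1 - G j - G j.+2 = a * (F j - G j.+1).
  have /= <- := min_kernel_laplacian (fun j => F j - G j.+1) j.
  by rewrite (GE j.+1) (GE j) (GE j.+2); ring.
have phin : phi n <= phi n.+1.
  rewrite /phi ler_wpM2l// lerD2l ler_wpM2l ?(ltW a0)//.
  rewrite -subr_ge0 -natr1.
  rewrite (_ : _ - _ = 2 * (n%:R - xi) + 1); last by ring.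
  by lra.
(* The second difference of the quadratic contributes -2 a B, which turns the constant 3 of the
   barrier into the 1 of the bound on [F]. *)
have phiL j : a * phi j.+1 + (2 * phi j.+1 - phi j - phi j.+2) =
    a * (B * (1 + a * (j.+1%:R - xi) ^+ 2)).
  by rewrite /phi -[j.+2%:R]natr1 -[j.+1%:R]natr1; ring.
have phi0 : B * (a * xi ^+ 2) <= phi 0%N.
  by rewrite /phi sub0r sqrrN ler_wpM2l//; lra.
(* The minimum principle is applied to [phi + (G - c)] and to [phi - (G - c)], which gives the two
   sides of the bound. *)
have main (e : R) : e = 1 \/ e = -1 -> 0 <= phi k + e * (G k - c).
  move=> e1; have ee : `|e| = 1 by case: e1 => ->; rewrite ?normrN normr1.
  apply: (@discrete_min_principle _ n a (fun k => phi k + e * (G k - c))) => //.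
  - rewrite G0 sub0r; have := ler_norm (e * c); rewrite normrM ee mul1r; lra.
  - by rewrite Gn lerD2r.
  - move=> j jn; have := GL (Ordinal jn); have /= Fj := Fc (Ordinal jn) => /= Gj.
    have := ler_norm (- (e * (F (Ordinal jn) - c))); rewrite normrN normrM ee mul1r => h.
    have -> : a * (phi j.+1 + e * (G j.+1 - c)) +
      (2 * (phi j.+1 + e * (G j.+1 - c)) - (phi j + e * (G j - c))
       - (phi j.+2 + e * (G j.+2 - c))) =
      a * phi j.+1 + (2 * phi j.+1 - phi j - phi j.+2) + e * (a * (G j.+1 - c)
       + (2 * G j.+1 - G j - G j.+2)) by ring.
    rewrite phiL Gj.
    have -> : a * (B * (1 + a * (j.+1%:R - xi) ^+ 2)) +
      e * (a * (G j.+1 - c) + a * (F (Ordinal jn) - G j.+1)) =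
      a * (B * (1 + a * (j.+1%:R - xi) ^+ 2) + e * (F (Ordinal jn) - c)) by ring.
    by apply: mulr_ge0; [exact: ltW | lra].
have := main 1 (or_introl erefl); have := main (-1) (or_intror erefl).
by rewrite -/(phi k) ler_norml => h1 h2; apply/andP; split; lra.
Qed.

(** Each term is at most 1/j - 1/(j + 1), and these telescope. *)
Lemma sum_inv_sqr_tail (R : realFieldType) (m n : nat) : (0 < m)%N ->
  \sum_(m <= j < n) (j.+1%:R ^+ 2)^-1 <= m%:R^-1 :> R.
Proof.
move=> m0; have [nm|mn] := leqP n m; first by rewrite big_geq.
apply: (@le_trans _ _ (\sum_(m <= j < n) (- j.+1%:R^-1 - - j%:R^-1))).
  apply: ler_sum_nat => j /andP[mj _].
  have j0 : 0 < j%:R :> R by rewrite ltr0n (leq_trans m0).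
  have j1 : 0 < j.+1%:R :> R by [].
  have -> : - j.+1%:R^-1 - - j%:R^-1 = (j.+1%:R * j%:R)^-1 :> R.
    by rewrite -natr1; field; rewrite natr1 !gt_eqF.
  rewrite lef_pV2 ?posrE ?mulr_gt0 ?exprn_gt0// expr2 ler_pM2l//.
  by rewrite ler_nat.
by rewrite (telescope_sumr (fun j => - j%:R^-1 : R)) ?(ltnW mn)// opprK gerDr oppr_le0 invr_ge0.
Qed.

(** * Summation by parts and sine coefficients of Hölder functions *)

Lemma abel_summation (R : comNzRingType) (n : nat) (F s : nat -> R) :
  \sum_(i < n.+1) F i * s i = F n * (\sum_(i < n.+1) s i)
    - \sum_(i < n) (F i.+1 - F i) * (\sum_(j < i.+1) s j).
Proof.
elim: n => [|n IH]; first by rewrite !big_ord1 big_ord0 subr0.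
rewrite big_ord_recr/= IH [in RHS]big_ord_recr/=.
rewrite [X in _ = _ - X]big_ord_recr/=; ring.
Qed.

(* [F] is replaced by a step function with steps of length [l], to which
   summation by parts is applied. *)
Lemma block_oscillating_sum (R : realDomainType) (n l : nat) (F s : nat -> R)
    (D M S : R) : (0 < l)%N -> 0 <= S ->
  (forall i j, (j <= i <= n)%N -> (i <= j + l)%N -> `|F i - F j| <= D) ->
  (forall i, (i <= n)%N -> `|F i| <= M) -> (forall i, `|s i| <= 1) ->
  (forall k, `|\sum_(i < k) s i| <= S) ->
  `|\sum_(i < n.+1) F i * s i| <= n.+1%:R * D + S * (M + (n %/ l)%:R * D).
Proof.
move=> l0 S0 osc bnd s1 hS; pose H i := F (i %/ l * l)%N.
have -> : \sum_(i < n.+1) F i * s i =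
    \sum_(i < n.+1) (F i - H i) * s i + \sum_(i < n.+1) H i * s i.
  by rewrite -big_split/=; apply: eq_bigr => i _; rewrite -mulrDl subrK.
apply: le_trans (ler_normD _ _) _; apply: lerD.
  apply: le_trans (ler_norm_sum _ _ _) _.
  rewrite mulr_natl -[X in _ *+ X]card_ord -sumr_const; apply: ler_sum => i _.
  rewrite normrM; have h : `|F i - H i| <= D.
    apply: osc; first by rewrite leq_divM -ltnS ltn_ord.
    by rewrite {1}(divn_eq i l) leq_add2l ltnW// ltn_mod.
  by apply: le_trans h; rewrite ler_piMr.
rewrite abel_summation; apply: le_trans (ler_normB _ _) _; rewrite mulrDr.
apply: lerD.
  rewrite normrM mulrC; apply: ler_pM => //; apply: bnd.
  exact: leq_divM.
apply: le_trans (ler_norm_sum _ _ _) _.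
(* The step function [H] is constant between multiples of [l] and moves by at most [D] when [i + 1]
   is such a multiple, which happens [n %/ l] times. *)
have step i : (i < n)%N -> `|(H i.+1 - H i) * \sum_(j < i.+1) s j| <=
    S * (D * (l %| i.+1)%N%:R).
  move=> ilt; rewrite normrM mulrC; apply: ler_pM => //.
  rewrite /H divnS//; case: (boolP (l %| i.+1)%N) => ldvd; last first.
    by rewrite add0n subrr normr0 mulr0.
  rewrite mulr1 add1n mulSn; apply: osc; last by rewrite addnC.
  rewrite leq_addl -mulSn /=; apply: leq_trans ilt.
  by rewrite [X in (X * _ <= _)%N](_ : _ = i.+1 %/ l)%N ?leq_divM// divnS// ldvd.
apply: le_trans (ler_sum _ (fun (i : 'I_n) _ => step i (ltn_ord i))) _.
rewrite -!mulr_sumr [D * _]mulrC; apply: ler_wpM2l => //.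
rewrite le_eqVlt; apply/orP; left; apply/eqP; congr (_ * _).
rewrite -natr_sum; congr _%:R; clear.
elim: n => [|n IH]; first by rewrite big_ord0 div0n.
rewrite big_ord_recr/= IH.
case: (posnP l) => [->|l0]; first by rewrite !divn0 dvd0n.
by rewrite divnS// addnC.
Qed.

Lemma holder_classP (R : realType) (alpha : R) (f : R -> R) :
  alpha != 0 -> holder_class alpha f ->
  exists2 L : R, 0 <= L & forall s t : R, 0 <= s <= 1 -> 0 <= t <= 1 ->
    `|f s - f t| <= L * `|s - t| `^ alpha.
Proof.
move=> a0 [L hL]; exists `|L| => // s t s01 t01.
(* On the diagonal, 0 to the power [alpha] must be 0; the convention 0^0 = 1 is why [alpha] is taken
   nonzero. *)
have [->|st] := eqVneq s t; first by rewrite !subrr !normr0 powR0// mulr0.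
have st0 : 0 < `|s - t| `^ alpha by rewrite powR_gt0// normr_gt0 subr_eq0.
rewrite -ler_pdivrMr//; apply: le_trans (hL s t s01 t01 st) _; exact: ler_norm.
Qed.

(** On blocks of length about n / (j + 1) the function oscillates by O((j + 1)^(-alpha)). There are
    at most j + 1 blocks, and each jump between them costs a partial sum of sines, of size O(N / (j
    + 1)). *)
Lemma holder_sine_coefficient (R : realType) (alpha : R) (f : R -> R) :
  0 < alpha <= 1 -> holder_class alpha f ->
  exists2 C : R, 0 <= C & forall n j : nat, (j < n)%N ->
    `|\sum_(i < n) f (design i) * sin (i.+1%:R * freq R n j)| <=
    C * (n%:R + 2^-1) * j.+1%:R `^ (- alpha).
Proof.
move=> /andP[a0 a1] hf.
have [L L0 hL] := holder_classP (lt0r_neq0 a0) hf.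
pose M := `|f 0| + L.
have M0 : 0 <= M by rewrite addr_ge0.
have fM (s : R) : 0 <= s <= 1 -> `|f s| <= M.
  move=> s01; rewrite -[f s](subrK (f 0)) addrC (le_trans (ler_normD _ _))// lerD2l.
  apply: le_trans (hL _ _ s01 _) _; first by rewrite lexx ler01.
  have : `|s - 0| `^ alpha <= 1 `^ alpha.
    rewrite ge0_ler_powR ?nnegrE ?(ltW a0)// subr0.
    by case/andP: s01 => s0 s1; rewrite ger0_norm.
  by rewrite powR1 => h; rewrite ler_piMr.
(* In 12 L, 4 L comes from the oscillation inside the blocks and 8 L from the jumps between them; 4
   M is the boundary term of the summation by parts. *)
exists (12 * L + 4 * M) => [|n j jn]; first by rewrite addr_ge0// mulr_ge0.
set N := n%:R + 2^-1; have N0 : 0 < N by rewrite /N ltr_wpDl.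
set q := j.+1; set p := q%:R `^ (- alpha).
have p0 : 0 <= p by exact: powR_ge0.
have q0 : 0 < q%:R :> R by [].
(* Rounding up keeps [l] positive and the number of jumps at most [q], while [l / N] stays below 2 /
   q. *)
pose l := (n %/ q).+1.
have lN : l%:R / N <= 2 / q%:R.
  rewrite ler_pdivrMr// mulrAC ler_pdivlMr// -natrM.
  have : (l * q <= 2 * n)%N.
    by rewrite /l mulSn mul2n -addnn leq_add// leq_divM.
  by rewrite -(ler_nat R) natrM => /le_trans; apply; rewrite /N; lra.
have nl : (n %/ l <= q)%N.
  by rewrite ltnW// ltn_divLR// mulnC ltn_ceil.
pose F (i : nat) : R := f (i%:R / N); pose s (i : nat) : R := sin (i%:R * freq R n j).
have dom i : (i <= n)%N -> 0 <= i%:R / N <= 1.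
  move=> ilen; rewrite divr_ge0 ?(ltW N0)//= ler_pdivrMr// mul1r /N.
  by move: ilen; rewrite -(ler_nat R) => ilen; lra.
have osc a b : (b <= a <= n)%N -> (a <= b + l)%N -> `|F a - F b| <= 2 * L * p.
  move=> /andP[ba an] abl; apply: le_trans (hL _ _ (dom _ an) (dom _ (leq_trans ba an))) _.
  rewrite -mulrBl -natrB// mulrC mulrAC; apply: ler_wpM2r => //.
  apply: (@le_trans _ _ ((2 / q%:R) `^ alpha)).
    rewrite ge0_ler_powR ?nnegrE ?(ltW a0)// ?divr_ge0//.
    rewrite ger0_norm ?divr_ge0 ?(ltW N0)//; apply: le_trans lN.
    by rewrite ler_pM2r ?invr_gt0// ler_nat leq_subLR.
  rewrite powRM ?invr_ge0 ?(ltW q0)// -powR_inv1 ?(ltW q0)// -powRrM mulN1r -/p.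
  by rewrite ler_wpM2r// -[leRHS]powRr1// ler_powR// ler1n.
have S0 : 0 <= 4 * N / q%:R by rewrite divr_ge0 ?mulr_ge0 ?(ltW N0).
have part k : `|\sum_(i < k) s i| <= 4 * N / q%:R.
  case: k => [|k]; first by rewrite big_ord0 normr0.
  rewrite big_ord_recl /s mul0r sin0 add0r.
  exact: sine_partial_sum.
have := @block_oscillating_sum R n l F s (2 * L * p) M (4 * N / q%:R) isT S0 osc
  (fun i h => fM _ (dom i h)) (fun i => sin_max _) part.
(* The block estimate starts at index 0, whereas the design starts at 1; the extra term is zero. *)
have s0 : s 0%N = 0 by rewrite /s mul0r sin0.
rewrite big_ord_recl s0 mulr0 add0r => /le_trans; apply.
have qp : q%:R^-1 <= p.
  by rewrite -powR_inv1 ?(ltW q0)// /p ler_powR ?lerN2// ler1n.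
have h1 : n.+1%:R * (2 * L * p) <= 4 * (N * (L * p)).
  have : n.+1%:R <= 2 * N by rewrite /N -natr1; have : 0 <= n%:R :> R by []; lra.
  have Lp : 0 <= 2 * L * p by rewrite !mulr_ge0.
  by move=> /(ler_wpM2r Lp); lra.
have h2 : 4 * N / q%:R * M <= 4 * (N * (M * p)).
  have NM : 0 <= 4 * N * M by rewrite !mulr_ge0 ?(ltW N0).
  by have := ler_wpM2l NM qp; lra.
have h3 : 4 * N / q%:R * ((n %/ l)%:R * (2 * L * p)) <= 8 * (N * (L * p)).
  have : (n %/ l)%:R / q%:R <= 1 :> R by rewrite ler_pdivrMr// mul1r ler_nat.
  have NLp : 0 <= 8 * (N * (L * p)) by rewrite !mulr_ge0 ?(ltW N0).
  by move=> /(ler_wpM2l NLp); lra.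
rewrite mulrDr; lra.
Qed.

(** * Spectral form of the posterior *)

Section eigenbasis.
Context (R : realType) (n : nat) (K : 'M[R]_n).
Context (mu : 'I_n -> R) (v : 'I_n -> 'cV[R]_n).
Hypothesis hv : ordered_eigenbasis K mu v.

Definition dotv (u w : 'cV[R]_n) : R := (u^T *m w) 0 0.

Lemma dotvE u w : dotv u w = \sum_i u i 0 * w i 0.
Proof. by rewrite /dotv mxE; apply: eq_bigr => i _; rewrite mxE. Qed.

Lemma dotvC u w : dotv u w = dotv w u.
Proof. by rewrite !dotvE; apply: eq_bigr => i _; rewrite mulrC. Qed.

Lemma dotvZr a u w : dotv u (a *: w) = a * dotv u w.
Proof. by rewrite /dotv -scalemxAr mxE. Qed.

Lemma dotv_sumr (P : pred 'I_n) (w : 'I_n -> 'cV[R]_n) u :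
  dotv u (\sum_(j | P j) w j) = \sum_(j | P j) dotv u (w j).
Proof. by rewrite /dotv mulmx_sumr summxE. Qed.

Lemma dotv_basis i j : dotv (v i) (v j) = (i == j)%:R.
Proof.
by case: hv => _ orth _ _; rewrite /dotv orth mxE eqxx mulr1n.
Qed.

(** Orthonormality says that the matrix of eigenvectors has its transpose as left inverse, and for
    square matrices this is also a right inverse. *)
Lemma eigenbasis_resolution : \sum_j v j *m (v j)^T = 1%:M.
Proof.
pose V := \matrix_(i, j) v j i 0.
have VV : V^T *m V = 1%:M.
  apply/matrixP => i j; rewrite !mxE -(dotv_basis i j) dotvE.
  by apply: eq_bigr => l _; rewrite !mxE.
rewrite -(mulmx1C VV); apply/matrixP => i j; rewrite summxE mxE.
by apply: eq_bigr => l _; rewrite mxE big_ord1 !mxE.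
Qed.

Lemma eigenbasis_expansion u : u = \sum_j dotv (v j) u *: v j.
Proof.
rewrite -[LHS]mul1mx -eigenbasis_resolution mulmx_suml.
apply: eq_bigr => j _; rewrite -mulmxA [(v j)^T *m u]mx11_scalar.
by rewrite mul_mx_scalar.
Qed.

Lemma parseval (P : pred 'I_n) (b : 'I_n -> R) :
  let u := \sum_(j | P j) b j *: v j in
  \sum_i u i 0 ^+ 2 = \sum_(j | P j) b j ^+ 2.
Proof.
move=> u; have -> : \sum_i u i 0 ^+ 2 = dotv u u.
  by rewrite dotvE; apply: eq_bigr => i _; rewrite expr2.
rewrite {2}/u dotv_sumr; apply: eq_bigr => j Pj.
rewrite dotvZr dotvC {}/u dotv_sumr (bigD1 j)//= dotvZr dotv_basis eqxx mulr1.
rewrite big1 ?addr0 ?expr2// => i /andP[_ ij].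
by rewrite dotvZr dotv_basis eq_sym (negbTE ij) mulr0.
Qed.

Lemma dotv_gram (P : pred 'I_n) p y (b : 'I_n -> R) :
  (p^T *m (\sum_(j | P j) b j *: (v j *m (v j)^T)) *m y) 0 0 =
  \sum_(j | P j) b j * dotv p (v j) * dotv (v j) y.
Proof.
rewrite mulmx_sumr mulmx_suml summxE; apply: eq_bigr => j _.
rewrite -scalemxAr -scalemxAl mxE -mulrA; congr (_ * _).
by rewrite mulmxA -(mulmxA (p^T *m v j)) mxE big_ord1.
Qed.

Lemma eigenbasis_matrix : K = \sum_j mu j *: (v j *m (v j)^T).
Proof.
case: hv => Kv _ _ _; rewrite -[LHS]mulmx1 -eigenbasis_resolution mulmx_sumr.
by apply: eq_bigr => j _; rewrite mulmxA Kv -scalemxAl.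
Qed.

Lemma eigenbasis_gram_dot p j : dotv (K *m p) (v j) = mu j * dotv p (v j).
Proof.
have symK : K^T = K.
  rewrite eigenbasis_matrix linear_sum; apply: eq_bigr => i _ /=.
  by rewrite linearZ/= trmx_mul trmxK.
case: hv => Kv _ _ _; rewrite /dotv trmx_mul symK -mulmxA Kv.
by rewrite -scalemxAr mxE.
Qed.

Lemma eigenvalue_ge0 j : 0 <= mu j. Proof. by case: hv. Qed.

Definition shrink (j : 'I_n) : R := mu j / (1 + mu j).

Lemma shrink_ge0 j : 0 <= shrink j.
Proof.
by rewrite divr_ge0 ?addr_ge0 ?eigenvalue_ge0.
Qed.

Lemma shrink_le1 j : shrink j <= 1.
Proof.
rewrite ler_pdivrMr ?mul1r ?lerDr//.
by rewrite ltr_wpDr ?eigenvalue_ge0.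
Qed.

Lemma shrink_le j : shrink j <= mu j.
Proof.
have m0 := eigenvalue_ge0 j.
by rewrite ler_pdivrMr ?ltr_wpDr// ler_peMr// lerDl.
Qed.

(** Once the kernel vector is written as [K *m p], symmetry of [K] moves a factor [mu j] onto each
    weight 1 / (1 + [mu j]), which makes it the shrinkage factor. *)
Lemma sgpr_mean p y m :
  ((K *m p)^T *m eigenvector_weight m mu v *m y) 0 0 =
  \sum_(j < n | (j < m)%N) shrink j * dotv p (v j) * dotv (v j) y.
Proof.
rewrite /eigenvector_weight dotv_gram; apply: eq_bigr => j _.
by rewrite eigenbasis_gram_dot /shrink mulrA [_^-1 * _]mulrC.
Qed.

Lemma sgpr_weight_norm p m :
  \sum_i ((K *m p)^T *m eigenvector_weight m mu v) 0 i ^+ 2 =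
  \sum_(j < n | (j < m)%N) (shrink j * dotv p (v j)) ^+ 2.
Proof.
rewrite -(parseval (fun j : 'I_n => (j < m)%N) (fun j => shrink j * dotv p (v j))).
apply: eq_bigr => i _; congr (_ ^+ 2).
(* The i-th weight is the posterior mean for the data vector [e], so [sgpr_mean] supplies its
   expansion in the eigenbasis. *)
pose e : 'cV[R]_n := delta_mx i 0.
have eE l : e l 0 = (l == i)%:R by rewrite mxE eqxx andbT.
transitivity (((K *m p)^T *m eigenvector_weight m mu v *m e) 0 0).
  rewrite [RHS]mxE (bigD1 i)//= big1 ?addr0 ?eE ?eqxx ?mulr1// => j ji.
  by rewrite eE (negbTE ji) mulr0.
rewrite sgpr_mean summxE; apply: eq_bigr => j _; rewrite [RHS]mxE; congr (_ * _).
rewrite dotvE (bigD1 i)//= big1 ?addr0 ?eE ?eqxx ?mulr1// => l li.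
by rewrite eE (negbTE li) mulr0.
Qed.

(** In a retained direction the data reduce mu to mu - mu^2 / (1 + mu), which is [shrink]; in a
    discarded one the prior variance mu stays. *)
Lemma sgpr_cov p m :
  (p^T *m K *m p) 0 0 -
    ((K *m p)^T *m eigenvector_weight m mu v *m (K *m p)) 0 0 =
  \sum_(j < n | (j < m)%N) shrink j * dotv p (v j) ^+ 2 +
  \sum_(j < n | ~~ (j < m)%N) mu j * dotv p (v j) ^+ 2.
Proof.
rewrite sgpr_mean [X in p^T *m X]eigenbasis_matrix dotv_gram.
rewrite (bigID (fun j : 'I_n => (j < m)%N))/= addrAC -sumrB; congr (_ + _).
  apply: eq_bigr => j _; rewrite [dotv (v j) (K *m p)]dotvC eigenbasis_gram_dot.
  rewrite dotvC /shrink; field.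
  by rewrite gt_eqF// ltr_wpDr ?eigenvalue_ge0.
by apply: eq_bigr => j _; rewrite [dotv (v j) p]dotvC; ring.
Qed.

(** Since mu (1 - shrink) = shrink in each direction, the fitted vector solves an equation in which
    no inverse appears; for the Brownian kernel this is the difference equation to which the barrier
    applies. *)
Lemma full_smoother F :
  let g := \sum_j (shrink j * dotv (v j) F) *: v j in g = K *m (F - g).
Proof.
move=> g; have [Kv _ _ _] := hv.
have -> : F - g = \sum_j ((1 - shrink j) * dotv (v j) F) *: v j.
  rewrite {1}(eigenbasis_expansion F) -sumrB; apply: eq_bigr => j _.
  by rewrite -scalerBl; congr (_ *: _); ring.
rewrite mulmx_sumr; apply: eq_bigr => j _; rewrite -scalemxAr Kv scalerA.
congr (_ *: _); rewrite /shrink; field.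
by rewrite gt_eqF// ltr_wpDr ?eigenvalue_ge0.
Qed.

(** The full posterior is the SGPR that keeps all [n] eigenvectors, so every bound for general [m]
    covers it too. *)
Lemma full_weight : invmx (K + 1%:M) = eigenvector_weight n mu v.
Proof.
have [Kv _ _ _] := hv.
have KW : (K + 1%:M) *m eigenvector_weight n mu v = 1%:M.
  rewrite /eigenvector_weight -[RHS]eigenbasis_resolution mulmx_sumr.
  apply: eq_big => [j|j _]; first by rewrite ltn_ord.
  rewrite -scalemxAr mulmxA mulmxDl Kv mul1mx -{2}[v j]scale1r -scalerDl.
  rewrite -scalemxAl scalerA [mu j + 1]addrC mulVf ?scale1r//.
  by rewrite gt_eqF// ltr_wpDr ?eigenvalue_ge0.
by have [Ku _] := mulmx1_unit KW; rewrite -[RHS](mulKmx Ku) KW mulmx1.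
Qed.

End eigenbasis.

(** * The Brownian Gram matrix *)

(** Strict growth gives i <= f i by induction; the same bound for [f] conjugated by the reversal of
    the indices gives f i <= i. *)
Lemma strictly_increasing_ord_id (n : nat) (f : 'I_n -> 'I_n) :
  (forall i j : 'I_n, (i < j)%N -> (f i < f j)%N) -> forall i, f i = i.
Proof.
have lower (g : 'I_n -> 'I_n) : (forall i j : 'I_n, (i < j)%N -> (g i < g j)%N) ->
    forall k (kn : (k < n)%N), (k <= g (Ordinal kn))%N.
  move=> gi; elim=> [//|k IH] kn; have k'n := ltnW kn.
  exact: leq_ltn_trans (IH k'n) (gi (Ordinal k'n) (Ordinal kn) (ltnSn k)).
move=> fi [i ilt]; apply/val_inj/eqP; rewrite eqn_leq (lower f fi i ilt) andbT.
pose g j := rev_ord (f (rev_ord j)).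
have gi (a b : 'I_n) : (a < b)%N -> (g a < g b)%N.
  move=> ab; have /fi : (rev_ord b < rev_ord a)%N.
    by have := ltn_ord b; rewrite /=; lia.
  have := ltn_ord (f (rev_ord a)); have := ltn_ord (f (rev_ord b)).
  by rewrite /g /=; lia.
have := lower g gi (rev_ord (Ordinal ilt)) (ltn_ord _).
rewrite (_ : Ordinal (ltn_ord _) = rev_ord (Ordinal ilt)); last exact: val_inj.
by rewrite /g rev_ordK /=; have := ltn_ord (f (Ordinal ilt)); lia.
Qed.

Section brownian_gram.
Context (R : realType) (n : nat) (c : R).
Hypothesis c_gt0 : 0 < c.

Local Notation N := (n%:R + 2^-1 : R).
Local Notation a := (c / N).
Local Notation k := (fun s t : R => c * Num.min s t).
Local Notation K := (gram k n).

Let N_gt0 : 0 < N. Proof. by rewrite ltr_wpDl. Qed.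
Let a_gt0 : 0 < a. Proof. exact: divr_gt0. Qed.

Lemma min_div (p q : R) : Num.min (p / N) (q / N) = Num.min p q / N.
Proof. by rewrite [RHS]mulrC minr_pMr ?invr_ge0 ?(ltW N_gt0)// !(mulrC N^-1). Qed.

Lemma min_natr (i j : nat) : Num.min i%:R j%:R = (minn i j)%:R :> R.
Proof. by case: (leqP i j) => ij; [apply/min_idPl | apply/min_idPr]; rewrite ler_nat ?(ltnW ij). Qed.

Lemma gramE i j : K i j = a * (minn i.+1 j.+1)%:R.
Proof. by rewrite mxE /design min_div min_natr; ring. Qed.

Definition sine_vec (j : nat) : 'cV[R]_n := \col_i sin (i.+1%:R * freq R n j).

Lemma gram_sine_vec (j : 'I_n) :
  K *m sine_vec j = (a / laplace_eig R n j) *: sine_vec j.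
Proof.
have l0 := laplace_eig_gt0 R (ltn_ord j).
apply/matrixP => i o; rewrite !mxE.
have /(_ i.+1 _ _ (ltn_ord i)) := @min_kernel_inverse R n (fun i => sin (i%:R * freq R n j)).
rewrite mul0r sin0 sine_neumann => /(_ erefl erefl) <-.
rewrite mulr_sumr; apply: eq_bigr => l _; rewrite gramE mxE sine_recurrence.
by field; rewrite (gt_eqF l0) gt_eqF.
Qed.

(** The given eigenbasis is forced to be the sine basis: the eigenvalues of the sine vectors are
    distinct and strictly decreasing, so the ordering identifies them with [mu], and each eigenspace
    is a line. Only the sign of [e] remains free. *)
Lemma gram_eigenbasis (mu : 'I_n -> R) (v : 'I_n -> 'cV[R]_n) :
  ordered_eigenbasis K mu v -> forall j : 'I_n,
  mu j = a / laplace_eig R n j /\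
  exists2 e : R, e ^+ 2 = 2 / N & v j = e *: sine_vec j.
Proof.
move=> hv; have [Kv _ mono _] := hv.
pose la (i : 'I_n) := a / laplace_eig R n i.
have S0 (i : 'I_n) : \sum_l sine_vec i l 0 ^+ 2 = N / 2.
  by rewrite -(sine_norm R (ltn_ord i)); apply: eq_bigr => l _; rewrite mxE.
have eqmu (i j : 'I_n) : dotv (v j) (sine_vec i) != 0 -> mu j = la i.
  move=> d0; have : dotv (K *m sine_vec i) (v j) = mu j * dotv (sine_vec i) (v j).
    exact: eigenbasis_gram_dot hv _ _.
  rewrite gram_sine_vec dotvC dotvZr [dotv (sine_vec i) _]dotvC.
  by move/(mulIf d0).
have ex (i : 'I_n) : {j | dotv (v j) (sine_vec i) != 0}.
  apply/sigW/existsP; rewrite -[X in is_true X]negbK negb_exists; apply/negP => /forallP h.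
  have z : sine_vec i = 0.
    rewrite (eigenbasis_expansion hv (sine_vec i)) big1// => j _.
    by have := h j; rewrite negbK => /eqP ->; rewrite scale0r.
  have := S0 i; rewrite z big1; last by move=> l _; rewrite mxE expr0n.
  by move/esym/eqP; rewrite mulf_eq0 invr_eq0 (gt_eqF N_gt0)/= pnatr_eq0.
(* [tau] sends a sine vector to an eigenvector not orthogonal to it, hence with the same eigenvalue;
   the two orderings make [tau] strictly increasing. *)
pose tau i := sval (ex i).
have tauE i : mu (tau i) = la i by apply: eqmu; rewrite /tau; case: (ex i).
have la_lt (i j : 'I_n) : (i < j)%N -> la j < la i.
  move=> ij; rewrite /la ltr_pM2l// ltf_pV2 ?posrE ?laplace_eig_gt0//.
  exact: laplace_eig_lt.
have tau_id : forall i, tau i = i.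
  apply: strictly_increasing_ord_id => i j ij.
  have := la_lt i j ij; rewrite -!tauE ltNge; apply: contraR.
  by rewrite -leqNgt; exact: mono.
have muE i : mu i = la i by rewrite -[in LHS](tau_id i).
move=> j; split; first exact: muE.
pose b := dotv (v j) (sine_vec j).
have sE : sine_vec j = b *: v j.
  rewrite {1}(eigenbasis_expansion hv (sine_vec j)) (bigD1 j)//= big1 ?addr0//.
  move=> i ij; have [->|/eqmu] := eqVneq (dotv (v i) (sine_vec j)) 0.
    by rewrite scale0r.
  rewrite muE => e; exfalso; move: ij; rewrite -(inj_eq val_inj) /= neq_ltn.
  by case/orP => /la_lt; rewrite e ltxx.
have bb : b ^+ 2 = N / 2.
  have vv : \sum_l v j l 0 ^+ 2 = 1.
    by under eq_bigr do rewrite expr2; rewrite -dotvE (dotv_basis hv) eqxx.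
  rewrite -(S0 j) -[LHS]mulr1 -vv mulr_sumr; apply: eq_bigr => l _.
  by rewrite sE mxE exprMn.
have b0 : b != 0.
  apply/eqP => b0; move/esym/eqP: bb; rewrite b0 expr0n/= mulf_eq0 invr_eq0.
  by rewrite (gt_eqF N_gt0)/= pnatr_eq0.
exists b^-1; first by rewrite exprVn bb invf_div.
by rewrite sE scalerA mulVf// scale1r.
Qed.

(** Between neighbouring design points the kernel is linear in [x], so [p] has the two linear
    interpolation weights as its only entries that can be nonzero. Applying [p] is therefore
    averaging over the neighbours of [x]. *)
Lemma interpolation_weights (x : R) : 1 <= x * N -> x * N < n%:R ->
  exists p : 'cV[R]_n, [/\ kvec k n x = K *m p,
    0 <= k x x - (p^T *m K *m p) 0 0 <= a
  & forall (w : 'cV[R]_n) (b t : R),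
    (forall i : 'I_n, `|i.+1%:R - x * N| <= 1 -> `|w i 0 - b| <= t) ->
    `|dotv p w - b| <= t].
Proof.
set xi := x * N => xi1 xin.
have xi0 : 0 <= xi by apply: le_trans xi1.
have xE : x = xi / N by rewrite /xi mulfK// gt_eqF.
have /andP[Lxi xiL] := truncn_itv xi0; set L := Num.truncn xi in Lxi xiL.
have L0 : (0 < L)%N by have := le_lt_trans xi1 xiL; rewrite ltr1n.
have Ln : (L < n)%N by rewrite -(ltr_nat R); apply: le_lt_trans xin.
have L1n : (L.-1 < n)%N by rewrite prednK// ltnW.
(* Index [i] stands for the design point (i + 1) / N, so the neighbours L / N and (L + 1) / N have
   indices L - 1 and L. *)
pose i1 := Ordinal L1n; pose i2 := Ordinal Ln.
have i12 : i1 != i2 by rewrite -(inj_eq val_inj)/=; lia.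
pose th := xi - L%:R.
have th0 : 0 <= th by rewrite subr_ge0.
have th1 : th <= 1 by rewrite -natr1 in xiL; rewrite /th; lra.
pose p : 'cV[R]_n := \col_i ((1 - th) * (i == i1)%:R + th * (i == i2)%:R).
have dp (f : 'I_n -> R) : \sum_i p i 0 * f i = (1 - th) * f i1 + th * f i2.
  have -> : \sum_i p i 0 * f i =
      \sum_i ((1 - th) * ((i == i1)%:R * f i) + th * ((i == i2)%:R * f i)).
    by apply: eq_bigr => i _; rewrite mxE mulrDl !mulrA.
  rewrite big_split/= -!mulr_sumr.
  rewrite (bigD1 i1)//= eqxx mul1r big1 ?addr0; last by move=> i /negbTE ->; rewrite mul0r.
  by rewrite (bigD1 i2)//= eqxx mul1r big1 ?addr0//; move=> i /negbTE ->; rewrite mul0r.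
have e1 : i1.+1%:R = L%:R :> R by rewrite /= prednK.
have Kp (i : 'I_n) : (K *m p) i 0 = a * Num.min xi i.+1%:R.
  rewrite mxE; under eq_bigr do rewrite mulrC.
  rewrite dp !gramE mulrCA (mulrCA th) -mulrDr; congr (_ * _).
  rewrite /= prednK//; case: (leqP i.+1 L) => iL.
    rewrite (minn_idPl (leqW iL)).
    rewrite (min_idPr _); first by ring.
    by apply: le_trans Lxi; rewrite ler_nat.
  rewrite (minn_idPr iL) -[L.+1%:R]natr1.
  rewrite (min_idPl _); first by rewrite /th; ring.
  by apply: (le_trans (ltW xiL)); rewrite ler_nat.
exists p; split.
- apply/matrixP => i o; rewrite ord1 Kp mxE /design {1}xE min_div; ring.
- have -> : (p^T *m K *m p) 0 0 = dotv p (K *m p) by rewrite /dotv mulmxA.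
  rewrite dotvE dp !Kp e1 /= (min_idPr Lxi) (min_idPl (ltW xiL)).
  (* The remainder is the variance of a Brownian bridge between the two neighbours. *)
  have -> : c * Num.min x x - ((1 - th) * (a * L%:R) + th * (a * xi)) = a * (th * (1 - th)).
    rewrite minxx {1}xE /th; field; exact: lt0r_neq0.
  have tt : 0 <= th * (1 - th) by rewrite mulr_ge0// subr_ge0.
  rewrite mulr_ge0 ?(ltW a_gt0)//= ler_piMr ?(ltW a_gt0)//.
  by rewrite mulr_ile1// ?subr_ge0//; lra.
- move=> w b t hw; rewrite dotvE dp.
  have h1 : `|w i1 0 - b| <= t.
    by apply: hw; rewrite e1 ler_norml /th -?natr1 in th0 th1 *; apply/andP; split; lra.
  have h2 : `|w i2 0 - b| <= t.
    by apply: hw; rewrite /= -natr1 ler_norml /th in th0 th1 *; apply/andP; split; lra.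
  have -> : (1 - th) * w i1 0 + th * w i2 0 - b =
    (1 - th) * (w i1 0 - b) + th * (w i2 0 - b) by ring.
  rewrite (le_trans (ler_normD _ _))// !normrM (ger0_norm th0) ger0_norm ?subr_ge0//.
  have th1' : 0 <= 1 - th by rewrite subr_ge0.
  have := ler_wpM2l th1' h1; have := ler_wpM2l th0 h2; lra.
Qed.

End brownian_gram.

(** * Bias and variance bounds *)

Lemma powR_le_1Dsqr (R : realType) (alpha t : R) : 0 <= alpha <= 1 -> 0 <= t ->
  t `^ alpha <= 1 + t ^+ 2.
Proof.
move=> /andP[a0 a1] t0; have [t1|t1] := leP t 1.
  apply: (@le_trans _ _ 1); last by rewrite lerDl sqr_ge0.
  by have := @ge0_ler_powR R alpha a0 t 1; rewrite powR1; apply; rewrite ?nnegrE.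
apply: le_trans (ler1_powR (ltW t1) a1) _.
by have := ler_wpM2l t0 (ltW t1); rewrite mulr1 -expr2; lra.
Qed.

Section deterministic_bounds.
Context (R : realType) (n : nat) (c h : R).
Hypothesis c_gt0 : 0 < c.
Hypothesis h_ge1 : 1 <= h.

Local Notation N := (n%:R + 2^-1 : R).
Local Notation a := (c / N).
Local Notation k := (fun s t : R => c * Num.min s t).
Local Notation K := (gram k n).

Hypothesis hE : c * N = h ^+ 2.
Hypothesis a_le1 : a <= 1.

Context (mu : 'I_n -> R) (v : 'I_n -> 'cV[R]_n).
Hypothesis hv : ordered_eigenbasis K mu v.

Let N_gt0 : 0 < N. Proof. by rewrite ltr_wpDl. Qed.
Let a_gt0 : 0 < a. Proof. exact: divr_gt0. Qed.
Let h_gt0 : 0 < h. Proof. exact: lt_le_trans h_ge1. Qed.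

Lemma eigenvalue_le j : mu j <= 4 * h ^+ 2 * (j.+1%:R ^+ 2)^-1.
Proof.
have [-> _] := gram_eigenbasis c_gt0 hv j.
rewrite -hE ler_pdivrMr ?laplace_eig_gt0//.
have := laplace_eig_ge R (ltn_ord j).
have q0 : 0 <= 4 * (c * N) * (j.+1%:R ^+ 2)^-1.
  by rewrite divr_ge0 ?sqr_ge0// !mulr_ge0 ?(ltW c_gt0) ?(ltW N_gt0).
move=> /(ler_wpM2l q0); apply: le_trans.
rewrite le_eqVlt; apply/orP; left; apply/eqP; field.
by rewrite !gt_eqF// ?ltr_wpDl// ?ltr_wpDr.
Qed.

Lemma sum_eigenvalue_tail m : (0 < m)%N ->
  \sum_(j < n | ~~ (j < m)%N) mu j <= 4 * h ^+ 2 * m%:R^-1.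
Proof.
move=> m0; have h0 : 0 <= 4 * h ^+ 2 by rewrite mulr_ge0 ?sqr_ge0.
apply: le_trans (ler_wpM2l h0 (sum_inv_sqr_tail R n m0)).
rewrite mulr_sumr.
under [X in X <= _]eq_bigl do rewrite -leqNgt.
rewrite (big_nat_widenl _ 0%N)// big_mkord.
by apply: ler_sum => j _; exact: eigenvalue_le.
Qed.

(** The effective dimension is of order [h]: up to J, about h, the factors are at most 1 and sum to
    at most 2 h; beyond J they are at most [mu j] and sum to at most 4 h^2 / J <= 4 h. *)
Lemma sum_shrink_le : \sum_j shrink mu j <= 6 * h.
Proof.
pose J := (Num.truncn h).+1.
have /andP[Jh hJ] := truncn_itv (ltW h_gt0); rewrite -/J in hJ.
have J2h : J%:R <= 2 * h by rewrite /J -natr1 mulr_natl mulr2n lerD.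
rewrite (bigID (fun j : 'I_n => (j < J)%N))/=.
have -> : 6 * h = 2 * h + 4 * h by ring.
apply: lerD.
  apply: (@le_trans _ _ (\sum_(j < n | (j < J)%N) 1)).
    by apply: ler_sum => j _; exact: (shrink_le1 hv).
  apply: le_trans J2h; case: (leqP J n) => Jn.
    by rewrite -(big_ord_widen n (fun=> 1))// sumr_const card_ord.
  rewrite (eq_bigl xpredT) => [|j]; last by rewrite (ltn_trans _ Jn).
  by rewrite sumr_const card_ord ler_nat ltnW.
apply: (@le_trans _ _ (\sum_(j < n | ~~ (j < J)%N) mu j)).
  by apply: ler_sum => j _; exact: (shrink_le hv).
apply: le_trans (sum_eigenvalue_tail (ltn0Sn _)) _.
rewrite -/J ler_pdivrMr ?ltr0n// expr2 mulrA ler_wpM2l// ?(ltW hJ)//.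
by rewrite mulr_ge0// ltW.
Qed.

Context (x : R) (p : 'cV[R]_n).
Hypothesis p_kvec : kvec k n x = K *m p.
Hypothesis p_var : 0 <= k x x - (p^T *m K *m p) 0 0 <= a.
Hypothesis p_avg : forall (w : 'cV[R]_n) (b t : R),
    (forall i : 'I_n, `|i.+1%:R - x * N| <= 1 -> `|w i 0 - b| <= t) ->
    `|dotv p w - b| <= t.

Let p_sine j : `|dotv p (sine_vec R n j)| <= 1.
Proof.
rewrite -[dotv _ _]subr0; apply: p_avg => i _.
by rewrite mxE subr0; exact: sin_max.
Qed.

(** Normalised sine vectors are spread out, with squared entries at most 2 / N, and averaging with
    [p] preserves this. *)
Lemma dotv_basis_sqr_le j : dotv p (v j) ^+ 2 <= 2 / N.
Proof.
have [_ [e eN ->]] := gram_eigenbasis c_gt0 hv j.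
rewrite dotvZr exprMn eN ler_piMr ?divr_ge0 ?(ltW N_gt0)//.
by rewrite -real_normK ?num_real// exprn_ile1.
Qed.

Lemma sum_shrink_sqr_le m :
  \sum_(j < n | (j < m)%N) shrink mu j * dotv p (v j) ^+ 2 <= 12 * (h / N).
Proof.
have t0 (j : 'I_n) : 0 <= shrink mu j * (2 / N).
  by rewrite mulr_ge0 ?(shrink_ge0 hv)// divr_ge0 ?(ltW N_gt0).
apply: (@le_trans _ _ (\sum_j shrink mu j * (2 / N))).
  rewrite [leRHS](bigID (fun j : 'I_n => (j < m)%N))/=.
  rewrite -[leLHS]addr0 lerD//; last by apply: sumr_ge0 => j _; exact: t0.
  apply: ler_sum => j _; apply: ler_wpM2l; first exact: (shrink_ge0 hv).
  exact: dotv_basis_sqr_le.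
rewrite -mulr_suml.
have N2 : 0 <= 2 / N by rewrite divr_ge0 ?(ltW N_gt0).
by have := ler_wpM2r N2 sum_shrink_le; lra.
Qed.

Lemma sgpr_noise_le m :
  \sum_i (((kvec k n x)^T *m eigenvector_weight m mu v) 0 i) ^+ 2 <= 12 * (h / N).
Proof.
rewrite p_kvec (sgpr_weight_norm hv); apply: le_trans (sum_shrink_sqr_le m).
apply: ler_sum => j _; rewrite exprMn ler_wpM2r ?sqr_ge0// expr2.
by rewrite ler_piMr ?(shrink_ge0 hv)// (shrink_le1 hv).
Qed.

Lemma sgpr_varE m : cov_fun k (eigenvector_weight m mu v) x x =
  (k x x - (p^T *m K *m p) 0 0) +
  (\sum_(j < n | (j < m)%N) shrink mu j * dotv p (v j) ^+ 2 +
   \sum_(j < n | ~~ (j < m)%N) mu j * dotv p (v j) ^+ 2).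
Proof. by rewrite -(sgpr_cov hv) /cov_fun p_kvec; ring. Qed.

Lemma sgpr_var_ge0 m : 0 <= cov_fun k (eigenvector_weight m mu v) x x.
Proof.
rewrite sgpr_varE; case/andP: p_var => p0 _; apply: addr_ge0 => //.
apply: addr_ge0; apply: sumr_ge0 => j _; rewrite mulr_ge0 ?sqr_ge0//.
  exact: (shrink_ge0 hv).
exact: (eigenvalue_ge0 hv).
Qed.

Lemma sgpr_var_le m : (0 < m)%N ->
  cov_fun k (eigenvector_weight m mu v) x x <=
  a + 12 * (h / N) + 8 * (h ^+ 2 / (N * m%:R)).
Proof.
move=> m0; rewrite sgpr_varE -[leRHS]addrA; case/andP: p_var => _ pa.
apply: lerD => //; apply: lerD; first exact: sum_shrink_sqr_le.
have N2 : 0 <= 2 / N by rewrite divr_ge0 ?(ltW N_gt0).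
apply: (@le_trans _ _ (\sum_(j < n | ~~ (j < m)%N) mu j * (2 / N))).
  apply: ler_sum => j _; rewrite ler_wpM2l ?(eigenvalue_ge0 hv)//.
  exact: dotv_basis_sqr_le.
rewrite -mulr_suml; have := ler_wpM2r N2 (sum_eigenvalue_tail m0).
by rewrite invfM; lra.
Qed.

Context (alpha L C : R) (f0 : R -> R).
Hypothesis alpha_01 : 0 < alpha <= 1.
Hypothesis L_ge0 : 0 <= L.
Hypothesis f0_holder : forall s t : R, 0 <= s <= 1 -> 0 <= t <= 1 ->
    `|f0 s - f0 t| <= L * `|s - t| `^ alpha.
Hypothesis x_01 : 0 < x < 1.
Hypothesis xN_le : x * N <= n%:R.

Let F : 'cV[R]_n := observations f0 (fun=> 0).
(** The first summand handles the Hölder increments. The second handles the boundary: the prior pins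
    paths to 0 at the origin, so the barrier must exceed |f0 x| there, at distance [x] from the
    target point. *)
Let B := (L + `|f0 x| / x ^+ 2) * h `^ (- alpha).

Let FE i : F i 0 = f0 (design i). Proof. by rewrite mxE addr0. Qed.

Lemma design_01 (i : 'I_n) : 0 <= (design i : R) <= 1.
Proof.
rewrite /design divr_ge0 ?(ltW N_gt0)//= ler_pdivrMr// mul1r.
by apply: (@le_trans _ _ n%:R); [rewrite ler_nat | rewrite lerDl].
Qed.

Lemma full_bias_le :
  `|\sum_j shrink mu j * dotv p (v j) * dotv (v j) F - f0 x| <= 4 * B.
Proof.
have [al0 al1] := andP alpha_01; have [x0 x1] := andP x_01.
pose g := \sum_j (shrink mu j * dotv (v j) F) *: v j.
have -> : \sum_j shrink mu j * dotv p (v j) * dotv (v j) F = dotv p g.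
  by rewrite /g dotv_sumr; apply: eq_bigr => j _; rewrite dotvZr mulrAC.
have gK : g = K *m (F - g) := full_smoother hv F.
pose G (l : nat) := a * \sum_(j < n) (minn l j.+1)%:R * (F j 0 - g j 0).
have gG (j : 'I_n) : g j 0 = G j.+1.
  rewrite {1}gK mxE /G mulr_sumr; apply: eq_bigr => i _.
  by rewrite gramE !mxE mulrA.
have xh0 : 0 <= `|f0 x| / x ^+ 2 by rewrite divr_ge0 ?sqr_ge0.
have p0 : 0 <= h `^ (- alpha) by exact: powR_ge0.
have B0 : 0 <= B by rewrite /B mulr_ge0// addr_ge0.
have aE : a = h ^+ 2 / N ^+ 2 by rewrite -hE; field; exact: lt0r_neq0.
have hh : h `^ (- alpha) * h `^ alpha = 1.
  by rewrite powRN mulVf// gt_eqF// powR_gt0.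
have barrier := @min_kernel_barrier R n a B (f0 x) (x * N) (fun j => F j 0) G
  a_gt0 B0 xN_le.
have {}barrier : forall l, (l <= n)%N -> `|G l - f0 x| <= B * (3 + a * (l%:R - x * N) ^+ 2).
  apply: barrier.
  - by move=> l; rewrite {1}/G; congr (_ * _); apply: eq_bigr => j _; rewrite gG.
  - move=> j; rewrite FE; apply: le_trans (f0_holder (design_01 j) _) _.
      by rewrite !ltW.
    have t0 : 0 <= h * `|design j - x| by rewrite mulr_ge0 ?(ltW h_gt0).
    have -> : a * (j.+1%:R - x * N) ^+ 2 = (h * `|design j - x|) ^+ 2.
      rewrite exprMn real_normK ?num_real// aE /design; field; exact: lt0r_neq0.
    have -> : `|design j - x| `^ alpha =
        h `^ (- alpha) * (h * `|design j - x|) `^ alpha.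
      by rewrite powRM ?(ltW h_gt0)// mulrA hh mul1r.
    (* In the bandwidth scale t = h |s - x|, the Hölder modulus t^alpha is at most 1 + t^2, which is
       the quadratic growth required by the barrier. *)
    have := @powR_le_1Dsqr R alpha _ _ t0; rewrite (ltW al0) al1 => /(_ isT) tle.
    rewrite mulrA; apply: ler_pM => //; rewrite ?mulr_ge0 ?powR_ge0//.
    by rewrite /B ler_wpM2r// lerDl.
  - have -> : a * (x * N) ^+ 2 = x ^+ 2 * h ^+ 2.
      by rewrite aE; field; exact: lt0r_neq0.
    (* At the origin the barrier is at least |f0 x| h^(2 - alpha), and h >= 1 with alpha <= 1 makes
       this at least |f0 x|. *)
    have hp : 1 <= h `^ (- alpha) * h ^+ 2.
      rewrite -hh ler_wpM2l//; apply: le_trans (ler1_powR h_ge1 al1) _.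
      by rewrite expr2 ler_peMl// ltW.
    have -> : `|f0 x| = `|f0 x| / x ^+ 2 * x ^+ 2 * 1.
      by rewrite mulr1 divfK// gt_eqF// exprn_gt0.
    apply: (@le_trans _ _ (`|f0 x| / x ^+ 2 * x ^+ 2 * (h `^ (- alpha) * h ^+ 2))).
      by rewrite ler_wpM2l// mulr_ge0// sqr_ge0.
    have -> : `|f0 x| / x ^+ 2 * x ^+ 2 * (h `^ (- alpha) * h ^+ 2) =
       `|f0 x| / x ^+ 2 * h `^ (- alpha) * (x ^+ 2 * h ^+ 2) by ring.
    apply: ler_wpM2r; first by rewrite mulr_ge0 ?sqr_ge0.
    by rewrite /B; apply: ler_wpM2r => //; rewrite lerDr.
(* At the neighbours of [x] the barrier is at most B (3 + a) <= 4 B. *)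
apply: p_avg => i xi; rewrite gG; apply: le_trans (barrier _ (ltn_ord i)) _.
rewrite mulrC ler_wpM2r//.
have : a * (i.+1%:R - x * N) ^+ 2 <= 1; last by lra.
rewrite -real_normK ?num_real// mulr_ile1 ?(ltW a_gt0)// ?exprn_ge0//.
by rewrite exprn_ile1.
Qed.

Hypothesis C_ge0 : 0 <= C.
Hypothesis f0_coef : forall j : nat, (j < n)%N ->
    `|\sum_(i < n) f0 (design i) * sin (i.+1%:R * freq R n j)| <=
    C * N * j.+1%:R `^ (- alpha).

(** In each term the normalisation 2 / N cancels the N of the sine coefficient, leaving at most
    [mu j] times 2 C m^(-alpha); the tail of the eigenvalues then contributes 4 h^2 / m. *)
Lemma truncation_bias_le m : (0 < m)%N ->
  `|\sum_(j < n | ~~ (j < m)%N) shrink mu j * dotv p (v j) * dotv (v j) F| <=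
  8 * C * (h ^+ 2 * m%:R `^ (-1 - alpha)).
Proof.
move=> m0; have [al0 al1] := andP alpha_01.
apply: le_trans (ler_norm_sum _ _ _) _.
have mpos : 0 < m%:R :> R by rewrite ltr0n.
apply: (@le_trans _ _ (\sum_(j < n | ~~ (j < m)%N)
    mu j * (2 * C * m%:R `^ (- alpha)))).
  apply: ler_sum => j; rewrite -leqNgt => mj.
  rewrite -mulrA normrM ger0_norm ?(shrink_ge0 hv)//.
  apply: ler_pM => //; rewrite ?(shrink_ge0 hv) ?(shrink_le hv)//.
  have [_ [e eN ->]] := gram_eigenbasis c_gt0 hv j.
  rewrite dotvZr [dotv (e *: _) F]dotvC dotvZr [dotv F _]dotvC.
  have -> : e * dotv p (sine_vec R n j) * (e * dotv (sine_vec R n j) F) =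
    e ^+ 2 * (dotv p (sine_vec R n j) * dotv (sine_vec R n j) F) by ring.
  rewrite eN normrM ger0_norm ?divr_ge0 ?(ltW N_gt0)// normrM.
  have d1 : `|dotv (sine_vec R n j) F| <= C * N * m%:R `^ (- alpha).
    have -> : dotv (sine_vec R n j) F =
        \sum_(i < n) f0 (design i) * sin (i.+1%:R * freq R n j).
      by rewrite dotvE; apply: eq_bigr => i _; rewrite FE mxE mulrC.
    apply: le_trans (f0_coef (ltn_ord j)) _.
    rewrite ler_wpM2l ?mulr_ge0 ?(ltW N_gt0)// !powRN lef_pV2 ?posrE ?powR_gt0//.
    by rewrite ge0_ler_powR ?nnegrE ?(ltW al0)// ler_nat (leq_trans mj).
  have -> : 2 * C * m%:R `^ (- alpha) = 2 / N * (1 * (C * N * m%:R `^ (- alpha))).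
    by field; exact: lt0r_neq0.
  rewrite ler_wpM2l ?divr_ge0 ?(ltW N_gt0)//.
  by apply: ler_pM => //; exact: p_sine.
rewrite -mulr_suml.
have C0 : 0 <= 2 * C * m%:R `^ (- alpha) by rewrite !mulr_ge0 ?powR_ge0.
apply: le_trans (ler_wpM2r C0 (sum_eigenvalue_tail m0)) _.
rewrite powRD; last by rewrite [m%:R == _]gt_eqF ?implybT.
by rewrite powR_inv1 ?(ltW mpos)//; lra.
Qed.

Lemma sgpr_bias_le m : (0 < m)%N ->
  `|mean_fun k (eigenvector_weight m mu v) F x - f0 x| <=
  4 * B + 8 * C * (h ^+ 2 * m%:R `^ (-1 - alpha)).
Proof.
move=> m0; rewrite /mean_fun p_kvec (sgpr_mean hv).
have := full_bias_le.
rewrite (bigID (fun j : 'I_n => (j < m)%N))/=.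
set S := \sum_(j < n | (j < m)%N) _; set T := \sum_(j < n | ~~ _) _ => hb.
(* The truncated mean is the full mean minus its discarded part. *)
have -> : S - f0 x = S + T - f0 x - T by ring.
apply: le_trans (ler_normB _ _) _; apply: lerD => //.
exact: truncation_bias_le.
Qed.

End deterministic_bounds.

(** * Rates *)

Section rates.
Context (R : realType) (alpha gamma : R) (n m : nat).
Hypothesis alpha_gt0 : 0 < alpha.
Hypothesis gamma_gt0 : 0 < gamma.
Hypothesis n_gt0 : (0 < n)%N.
Hypothesis m_gt0 : (0 < m)%N.

Local Notation N := (n%:R + 2^-1 : R).

Definition prior_scale : R := N `^ ((1 - 2 * gamma) / (1 + 2 * gamma)).

Definition inv_bandwidth : R := N `^ (1 / (1 + 2 * gamma)).

Definition smooth_rate : R := n%:R `^ (- Num.min alpha gamma / (1 + 2 * gamma)).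

Definition bias_rate : R := n%:R `^ (2 / (1 + 2 * gamma)) * m%:R `^ (-1 - alpha).

Definition spread_rate : R :=
  n%:R `^ ((3 / 2 - gamma) / (1 + 2 * gamma)) * m%:R `^ (- (3 / 2)).

Let u_gt0 : 0 < 1 + 2 * gamma. Proof. by rewrite ltr_wpDr// mulr_ge0// ltW. Qed.
Let u_neq0 : 1 + 2 * gamma != 0. Proof. exact: lt0r_neq0. Qed.
Let n_ge1 : 1 <= n%:R :> R. Proof. by rewrite ler1n. Qed.
Let nR_gt0 : 0 < n%:R :> R. Proof. exact: lt_le_trans n_ge1. Qed.
Let nN : n%:R <= N. Proof. by rewrite lerDl. Qed.
Let N_ge1 : 1 <= N. Proof. exact: le_trans nN. Qed.
Let N_gt0 : 0 < N. Proof. exact: lt_le_trans N_ge1. Qed.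
Let N_le : N <= 2 * n%:R. Proof. by move: n_ge1; lra. Qed.
Let mR_gt0 : 0 < m%:R :> R. Proof. by rewrite ltr0n. Qed.

Let powN r s : N `^ r * N `^ s = N `^ (r + s).
Proof. by rewrite powRD// (gt_eqF N_gt0) implybT. Qed.

Let pown r s : n%:R `^ r * n%:R `^ s = n%:R `^ (r + s) :> R.
Proof. by rewrite powRD// (gt_eqF nR_gt0) implybT. Qed.

Let powm r s : m%:R `^ r * m%:R `^ s = m%:R `^ (r + s) :> R.
Proof. by rewrite powRD// (gt_eqF mR_gt0) implybT. Qed.

Let N1 : N = N `^ 1. Proof. by rewrite powRr1 ?(ltW N_gt0). Qed.
Let NV : N^-1 = N `^ (-1). Proof. by rewrite powR_inv1 ?(ltW N_gt0). Qed.

Lemma prior_scale_gt0 : 0 < prior_scale. Proof. exact: powR_gt0. Qed.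

Lemma inv_bandwidth_ge1 : 1 <= inv_bandwidth.
Proof.
rewrite -(powRr0 N) /inv_bandwidth ler_powR//.
by rewrite divr_ge0 ?(ltW u_gt0).
Qed.

Lemma prior_scaleE : prior_scale * N = inv_bandwidth ^+ 2.
Proof.
rewrite /prior_scale [X in _ * X = _]N1 powN expr2 powN; congr (_ `^ _); field.
exact: u_neq0.
Qed.

Lemma prior_scale_le : prior_scale <= inv_bandwidth.
Proof.
rewrite ler_powR// ler_pM2r ?invr_gt0//; move: gamma_gt0; lra.
Qed.

Lemma prior_scale_div_le1 : prior_scale / N <= 1.
Proof.
rewrite ler_pdivrMr// mul1r [X in _ <= X]N1 ler_powR// ler_pdivrMr//.
move: gamma_gt0; lra.
Qed.

Lemma smooth_rate_gt0 : 0 < smooth_rate. Proof. exact: powR_gt0. Qed.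
Lemma bias_rate_ge0 : 0 <= bias_rate. Proof. by rewrite mulr_ge0 ?powR_ge0. Qed.
Lemma spread_rate_ge0 : 0 <= spread_rate. Proof. by rewrite mulr_ge0 ?powR_ge0. Qed.

Let powN_le_pown r : r <= 0 -> N `^ r <= n%:R `^ r.
Proof.
move=> r0; rewrite -[r]opprK !(powRN _ (- r)) lef_pV2 ?posrE ?powR_gt0//.
by rewrite ge0_ler_powR ?nnegrE ?oppr_ge0// ltW.
Qed.

Lemma full_bias_rate_le : inv_bandwidth `^ (- alpha) <= smooth_rate.
Proof.
rewrite /inv_bandwidth -powRrM.
have r0 : 1 / (1 + 2 * gamma) * - alpha <= 0.
  by rewrite mulrN oppr_le0 mulr_ge0 ?divr_ge0 ?(ltW u_gt0) ?(ltW alpha_gt0).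
apply: le_trans (powN_le_pown r0) _; rewrite /smooth_rate ler_powR//.
rewrite mul1r mulrC ler_pM2r ?invr_gt0// lerN2.
by rewrite ge_min lexx.
Qed.

Lemma truncation_rate_le :
  inv_bandwidth ^+ 2 * m%:R `^ (-1 - alpha) <= 4 * bias_rate.
Proof.
rewrite /bias_rate mulrA ler_wpM2r ?powR_ge0//.
rewrite /inv_bandwidth expr2 powN.
have -> : 1 / (1 + 2 * gamma) + 1 / (1 + 2 * gamma) = 2 / (1 + 2 * gamma) by field.
set r := 2 / _; have r0 : 0 <= r by rewrite divr_ge0// ltW.
apply: (@le_trans _ _ ((2 * n%:R) `^ r)).
  by apply: ge0_ler_powR; rewrite ?nnegrE ?(ltW N_gt0).
rewrite powRM// ler_wpM2r ?powR_ge0//.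
have -> : 4 = 2 `^ 2 :> R by rewrite powR_mulrn//; ring.
rewrite ler_powR ?ler1n// /r ler_pdivrMr//; move: gamma_gt0; lra.
Qed.

Lemma variance_rate_le : inv_bandwidth / N <= smooth_rate ^+ 2.
Proof.
rewrite /inv_bandwidth NV powN expr2 pown.
have -> : 1 / (1 + 2 * gamma) + -1 = - (2 * gamma) / (1 + 2 * gamma) by field.
have r0 : - (2 * gamma) / (1 + 2 * gamma) <= 0.
  by rewrite mulNr oppr_le0 divr_ge0 ?(ltW u_gt0)// mulr_ge0// ltW.
apply: le_trans (powN_le_pown r0) _; rewrite ler_powR//.
rewrite -mulrDl ler_pM2r ?invr_gt0// -opprD lerN2.
have : Num.min alpha gamma <= gamma by rewrite ge_min lexx orbT.
lra.
Qed.

(** The left side is of order y q, where y bounds h / N and q = w / m, while the squared spread rate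
    is y q^3. Since q <= 1 + q^3, y q is at most y, itself below the squared smooth rate, plus y
    q^3. *)
Lemma spread_rate_le :
  inv_bandwidth ^+ 2 / (N * m%:R) <= 2 * (smooth_rate ^+ 2 + spread_rate ^+ 2).
Proof.
set w := n%:R `^ (1 / (1 + 2 * gamma)) : R.
set y := n%:R `^ (- (2 * gamma) / (1 + 2 * gamma)) : R.
have w0 : 0 <= w by exact: powR_ge0.
have y0 : 0 <= y by exact: powR_ge0.
have r0 : - (2 * gamma) / (1 + 2 * gamma) <= 0.
  by rewrite mulNr oppr_le0 divr_ge0 ?(ltW u_gt0)// mulr_ge0// ltW.
have hw : inv_bandwidth <= 2 * w.
  rewrite /inv_bandwidth; set r := 1 / _.
  have rr : 0 <= r by rewrite divr_ge0// ltW.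
  apply: (@le_trans _ _ ((2 * n%:R) `^ r)).
    by apply: ge0_ler_powR; rewrite ?nnegrE ?(ltW N_gt0).
  rewrite powRM// ler_wpM2r ?powR_ge0// -[leRHS]powRr1// ler_powR ?ler1n//.
  by rewrite /r ler_pdivrMr//; move: gamma_gt0; lra.
have hy : inv_bandwidth / N <= y.
  rewrite /inv_bandwidth NV powN.
  have -> : 1 / (1 + 2 * gamma) + -1 = - (2 * gamma) / (1 + 2 * gamma) by field.
  exact: powN_le_pown.
have yA : y <= smooth_rate ^+ 2.
  rewrite expr2 pown ler_powR// -mulrDl ler_pM2r ?invr_gt0// -opprD lerN2.
  have : Num.min alpha gamma <= gamma by rewrite ge_min lexx orbT.
  lra.
have yD : y * (w / m%:R) ^+ 3 = spread_rate ^+ 2.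
  have -> : spread_rate ^+ 2 = n%:R `^ ((3 - 2 * gamma) / (1 + 2 * gamma)) * m%:R `^ (- 3).
    rewrite /spread_rate expr2 mulrACA pown powm.
    by congr (_ `^ _ * _ `^ _); field.
  rewrite expr_div_n -(powR_mulrn 3 w0) /w -powRrM -(powR_mulrn 3 (ltW mR_gt0)).
  rewrite mulrA pown -powRN; congr (_ `^ _ * _ `^ _); by field.
have q0 : 0 <= w / m%:R by rewrite divr_ge0 ?(ltW mR_gt0).
have b0 : 0 <= inv_bandwidth / N by rewrite divr_ge0 ?powR_ge0 ?(ltW N_gt0).
have : inv_bandwidth ^+ 2 / (N * m%:R) <= 2 * (y * (w / m%:R)).
  have -> : inv_bandwidth ^+ 2 / (N * m%:R) =
     (inv_bandwidth / N) * (inv_bandwidth / m%:R).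
    by field; rewrite !gt_eqF.
  have -> : 2 * (y * (w / m%:R)) = y * (2 * w / m%:R) by ring.
  apply: ler_pM => //; first by rewrite divr_ge0 ?powR_ge0 ?(ltW mR_gt0).
  by rewrite ler_pM2r ?invr_gt0.
move=> /le_trans; apply; rewrite ler_pM2l// -yD.
have : w / m%:R <= 1 + (w / m%:R) ^+ 3.
  set q := w / m%:R in q0 *; have [q1|q1] := leP q 1.
    by rewrite (le_trans q1)// lerDl exprn_ge0.
  apply: (@le_trans _ _ (q ^+ 3)); last by rewrite lerDr.
  by rewrite -[leLHS]expr1 ler_weXn2l// ltW.
move=> /(ler_wpM2l y0); rewrite mulrDr mulr1 => /le_trans; apply.
by rewrite lerD2r.
Qed.

(** At m = n^E the bias exponent becomes exactly -alpha / (1 + 2 gamma). For the spread term, m >=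
    n^(1 / (1 + 2 gamma)) already gives -gamma / (1 + 2 gamma), and E is at least that exponent. *)
Lemma rate_le_smooth :
  n%:R `^ (1 / (1 + 2 * gamma) * ((2 + alpha) / (1 + alpha))) <= m%:R ->
  smooth_rate + bias_rate + spread_rate <= 3 * smooth_rate.
Proof.
set E := _ * (_ / _) => nm.
have a1 : 0 < 1 + alpha by rewrite ltr_wpDr// ltW.
have mpow r : 0 <= r -> m%:R `^ (- r) <= n%:R `^ (- (E * r)).
  move=> r0; rewrite !powRN lef_pV2 ?posrE ?powR_gt0// powRrM.
  by rewrite ge0_ler_powR ?nnegrE ?powR_ge0.
have bA : bias_rate <= smooth_rate.
  rewrite /bias_rate -opprD.
  apply: (@le_trans _ _ (n%:R `^ (2 / (1 + 2 * gamma)) * n%:R `^ (- (E * (1 + alpha))))).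
    by rewrite ler_wpM2l ?powR_ge0// mpow// ltW.
  rewrite pown ler_powR//.
  have -> : 2 / (1 + 2 * gamma) - E * (1 + alpha) = - alpha / (1 + 2 * gamma).
    by rewrite /E; field; rewrite u_neq0 gt_eqF.
  by rewrite ler_pM2r ?invr_gt0// lerN2 ge_min lexx.
have dA : spread_rate <= smooth_rate.
  rewrite /spread_rate.
  apply: (@le_trans _ _ (n%:R `^ ((3 / 2 - gamma) / (1 + 2 * gamma))
      * n%:R `^ (- (E * (3 / 2))))).
    by rewrite ler_wpM2l ?powR_ge0// mpow.
  rewrite pown ler_powR//.
  apply: (@le_trans _ _ (- gamma / (1 + 2 * gamma))); last first.
    by rewrite ler_pM2r ?invr_gt0// lerN2 ge_min lexx orbT.
  have E1 : 1 / (1 + 2 * gamma) <= E.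
    rewrite /E ler_peMr ?divr_ge0 ?(ltW u_gt0)// ler_pdivlMr// mul1r; lra.
  have -> : - gamma / (1 + 2 * gamma) =
    (3 / 2 - gamma) / (1 + 2 * gamma) - 1 / (1 + 2 * gamma) * (3 / 2) by field.
  by rewrite lerD2l lerN2; lra.
lra.
Qed.

End rates.

(** * Assembling the tail bound and passing to the limit *)

(** The constant depends only on [alpha], [f0] and [x], so the bound is uniform in [n], [m], the
    eigenbasis and the posterior; it serves both the sparse and the full posterior. *)
Lemma sgpr_tail_le (R : realType) (alpha gamma : R) (f0 : R -> R) (x : R) :
  0 < alpha <= 1 -> 0 < gamma <= 1 -> holder_class alpha f0 -> 0 < x < 1 ->
  exists2 C : R, 0 <= C &
  forall (n m : nat) (d : measure_display) (T : measurableType d)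
    (P : probability T R) (eps : 'I_n -> {RV P >-> measurableTypeR R})
    (mu : 'I_n -> R) (v : 'I_n -> 'cV[R]_n)
    (Q : T -> probability (path_space R) R) (t : R),
  (0 < m)%N -> 1 <= x * (n%:R + 2^-1) -> x * (n%:R + 2^-1) < n%:R ->
  iid_std_normal eps ->
  ordered_eigenbasis (gram (rbm_kernel gamma n) n) mu v ->
  (forall w, is_sgpr gamma m mu v
     (observations f0 (fun i => eps i w)) (Q w)) ->
  0 < t ->
  (\int[P]_w Q w [set f : path_space R | (t < `|f x - f0 x|)%R] <=
   (C * (smooth_rate alpha gamma n + bias_rate alpha gamma n m
         + spread_rate gamma n m) ^+ 2 / t ^+ 2)%:E)%E.
Proof.
move=> al ga hf x01; have [al0 al1] := andP al; have [ga0 ga1] := andP ga.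
have [L L0 hL] := holder_classP (lt0r_neq0 al0) hf.
have [C C0 hC] := holder_sine_coefficient al hf.
have [x0 x1] := andP x01.
pose C1 := 4 * (L + `|f0 x| / x ^+ 2) + 32 * C.
have fx0 : 0 <= `|f0 x| / x ^+ 2 by rewrite divr_ge0 ?sqr_ge0.
have C10 : 0 <= C1 by rewrite addr_ge0 ?mulr_ge0 ?addr_ge0.
(* Here 221 = 29 + 16 * 12 collects the posterior variance, at most 29 A^2 + 16 D^2, and the noise,
   at most 12 A^2; the bias adds 2 C1^2. *)
exists (32 * (221 + 2 * C1 ^+ 2)).
  apply: mulr_ge0; first exact: ler0n.
  by apply: addr_ge0; [exact: ler0n | rewrite mulr_ge0 ?sqr_ge0].
move=> n m d T P eps mu v Q t m0 xN1 xNn iid hv hQ t0.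
have n0 : (0 < n)%N.
  by rewrite -(ltr_nat R); apply: lt_trans xNn; apply: lt_le_trans xN1.
set A := smooth_rate _ _ _; set B := bias_rate _ _ _ _; set D := spread_rate _ _ _.
have A0 : 0 < A := smooth_rate_gt0 alpha gamma n0.
have B0 : 0 <= B := bias_rate_ge0 alpha gamma n m.
have D0 : 0 <= D := spread_rate_ge0 gamma n m.
have c0 := prior_scale_gt0 gamma n0.
have h1 := inv_bandwidth_ge1 ga0 n0.
have hE := prior_scaleE ga0 n0.
have a1 := prior_scale_div_le1 ga0 n0.
have [p [pk pv pa]] := interpolation_weights c0 xN1 xNn.
have V0 := sgpr_var_ge0 hv pk pv m.
apply: le_trans (expected_posterior_tail iid hQ _ V0 t0) _.
  by rewrite !ltW.
rewrite lee_fin ler_pM2r ?invr_gt0 ?exprn_gt0// -mulrA ler_pM2l//.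
have hV := sgpr_var_le c0 h1 hE hv pk pv pa m0.
have hZ := sgpr_noise_le c0 h1 hE hv pk pa m.
have hb := sgpr_bias_le c0 h1 hE a1 hv pk pa al L0 hL x01 (ltW xNn) C0
  (hC n) m0.
have N0 : 0 < n%:R + 2^-1 :> R by rewrite ltr_wpDl.
have t1 := full_bias_rate_le al0 ga0 n0.
have t2 := truncation_rate_le alpha m ga0 n0.
have t3 := variance_rate_le alpha ga0 n0.
have t4 := spread_rate_le alpha ga0 n0 m0.
have t5 : prior_scale gamma n / (n%:R + 2^-1) <= A ^+ 2.
  apply: le_trans t3; rewrite ler_pM2r ?invr_gt0//.
  exact: prior_scale_le.
set b := mean_fun _ _ _ _ - _ in hb *.
have {hb} hb : `|b| <= C1 * (A + B).
  apply: le_trans hb _.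
  have e1 : (L + `|f0 x| / x ^+ 2) * inv_bandwidth gamma n `^ (- alpha) <=
     (L + `|f0 x| / x ^+ 2) * A by rewrite ler_wpM2l// addr_ge0.
  have e2 := ler_wpM2l C0 t2.
  have e3 : 0 <= (L + `|f0 x| / x ^+ 2) * B by rewrite mulr_ge0// addr_ge0.
  have e4 : 0 <= C * A by rewrite mulr_ge0// ltW.
  by rewrite /C1; move: e1 e2 e3 e4; rewrite -/A -/B; lra.
have hb2 : b ^+ 2 <= C1 ^+ 2 * (A + B) ^+ 2.
  rewrite -exprMn -real_normK ?num_real// lerXn2r ?nnegrE//.
  by rewrite mulr_ge0// addr_ge0// ltW.
set Vx := cov_fun _ _ _ _ in hV *; set Z := \sum_i _ in hZ *.
have {hV} hV : Vx <= 29 * A ^+ 2 + 16 * D ^+ 2.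
  by move: hV t3 t4 t5; rewrite -/A -/D; lra.
have {hZ} hZ : Z <= 12 * A ^+ 2 by move: hZ t3; rewrite -/A; lra.
have s1 : A ^+ 2 + D ^+ 2 <= (A + B + D) ^+ 2.
  rewrite -subr_ge0 (_ : _ - _ = 2 * A * (B + D) + B ^+ 2 + 2 * B * D); last by ring.
  by rewrite !addr_ge0// ?mulr_ge0 ?addr_ge0 ?sqr_ge0// ltW.
have s2 : (A + B) ^+ 2 <= (A + B + D) ^+ 2.
  by rewrite lerXn2r ?nnegrE ?addr_ge0 ?(ltW A0)// lerDl.
have s3 := ler_wpM2l (sqr_ge0 C1) s2.
have A2 := sqr_ge0 A; have D2 := sqr_ge0 D.
lra.
Qed.

(** At t = M rho the bound is at most 9 C / M^2, which tends to 0. Separating the proved rate [r]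
    from the target rate [rho] allows the extra terms of [r] to be absorbed. *)
Lemma contracts_at_tail (R : realType) (d : nat -> measure_display)
    (Omega : forall n, measurableType (d n))
    (P : forall n, probability (Omega n) R)
    (Q : forall n, Omega n -> probability (path_space R) R)
    (f0 : R -> R) (x C : R) (r rho : nat -> R) :
  0 <= C ->
  (\forall n \near \oo, 0 <= r n <= 3 * rho n /\ 0 < rho n) ->
  (\forall n \near \oo, forall t, 0 < t ->
    (\int[P n]_w Q n w [set f : path_space R | (t < `|f x - f0 x|)%R] <=
     (C * r n ^+ 2 / t ^+ 2)%:E)%E) ->
  contracts_at P Q f0 x rho.
Proof.
move=> C0 hr htail M Moo.
have Mpos : \forall n \near \oo, 0 < M n.
  by have /cvgryPgt/(_ 0) := Moo.
have MV : (C * 9 * (M n)^-1 ^+ 2)%:E @[n --> \oo] --> 0%E.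
  apply: cvg_EFin; first exact: nearW.
  have MV0 : (M n)^-1 @[n --> \oo] --> (0 : R) by apply/gtr0_cvgV0.
  rewrite (_ : _ \o _ = (fun n => C * 9 * ((M n)^-1 * (M n)^-1))); last first.
    by apply/funext => n /=; rewrite expr2.
  have -> : (0 : R) = C * 9 * (0 * 0) by rewrite !mulr0.
  by apply: cvgM; [exact: cvg_cst | exact: cvgM].
apply: (squeeze_cvge _ (cvg_cst 0%E) MV).
near=> n; apply/andP; split.
  by apply: integral_ge0 => w _; exact: measure_ge0.
have M0 : 0 < M n by near: n.
have [/andP[r0 r3] rho0] : 0 <= r n <= 3 * rho n /\ 0 < rho n by near: n.
have tail : forall t, 0 < t ->
    (\int[P n]_w Q n w [set f : path_space R | (t < `|f x - f0 x|)%R] <=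
     (C * r n ^+ 2 / t ^+ 2)%:E)%E by near: n.
apply: le_trans (tail (M n * rho n) (mulr_gt0 M0 rho0)) _.
rewrite lee_fin ler_pdivrMr ?exprn_gt0 ?mulr_gt0//.
have -> : C * 9 * (M n)^-1 ^+ 2 * (M n * rho n) ^+ 2 = C * (3 * rho n) ^+ 2.
  by field; exact: lt0r_neq0.
rewrite ler_wpM2l// lerXn2r// nnegrE.
exact: le_trans r3.
Unshelve. all: by end_near.
Qed.

Lemma interior_design_near (R : realType) (x : R) : 0 < x < 1 ->
  \forall n \near \oo, [/\ (0 < n)%N, 1 <= x * (n%:R + 2^-1) & x * (n%:R + 2^-1) < n%:R].
Proof.
move=> /andP[x0 x1].
have y0 : 0 < 1 - x by rewrite subr_gt0.
near=> n.
have n1 : x^-1 <= n%:R by near: n; exact: nbhs_infty_ger.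
have n2 : (1 - x)^-1 <= n%:R by near: n; exact: nbhs_infty_ger.
have np : 0 < n%:R :> R by apply: lt_le_trans n1; rewrite invr_gt0.
have h1 : 1 <= x * n%:R by rewrite mulrC -ler_pdivrMr// mul1r.
have h2 : 1 <= (1 - x) * n%:R by rewrite mulrC -ler_pdivrMr// mul1r.
split; [by rewrite ltr0n in np | lra | lra].
Unshelve. all: by end_near.
Qed.

Theorem theorem3p5 (R : realType) (alpha gamma : R) (f0 : R -> R) (x : R)
    (d : nat -> measure_display) (Omega : forall n : nat, measurableType (d n))
    (P : forall n : nat, probability (Omega n) R)
    (eps : forall n : nat, 'I_n -> {RV (P n) >-> measurableTypeR R})
    (mu : forall n : nat, 'I_n -> R) (v : forall n : nat, 'I_n -> 'cV[R]_n)
    (m : nat -> nat)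
    (Q : forall n : nat, Omega n -> probability (path_space R) R) :
  0 < alpha <= 1 -> 0 < gamma <= 1 ->
  holder_class alpha f0 ->
  0 < x < 1 ->
  (forall n : nat, iid_std_normal (@eps n)) ->
  (forall n : nat,
     ordered_eigenbasis (gram (rbm_kernel gamma n) n) (@mu n) (@v n)) ->
  (forall n : nat, (m n <= n)%N) ->
  m n @[n --> \oo] --> \oo ->
  (forall (n : nat) (w : Omega n),
     is_sgpr gamma (m n) (@mu n) (@v n)
       (observations f0 (fun i : 'I_n => eps n i w)) (Q n w)) ->
  contracts_at P Q f0 x (fun n : nat =>
    n%:R `^ (- Num.min alpha gamma / (1 + 2 * gamma))
    + n%:R `^ (2 / (1 + 2 * gamma)) * (m n)%:R `^ (-1 - alpha)
    + n%:R `^ ((3 / 2 - gamma) / (1 + 2 * gamma)) * (m n)%:R `^ (- (3 / 2)))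
  /\
  (n%:R `^ (1 / (1 + 2 * gamma) * ((2 + alpha) / (1 + alpha))) / (m n)%:R
     @[n --> \oo] --> (0 : R) ->
   let rate (n : nat) : R :=
     n%:R `^ (- Num.min alpha gamma / (1 + 2 * gamma)) in
   contracts_at P Q f0 x rate /\
   forall Pi : (forall n : nat, Omega n -> probability (path_space R) R),
     (forall (n : nat) (w : Omega n),
        is_full_posterior gamma
          (observations f0 (fun i : 'I_n => eps n i w)) (Pi n w)) ->
     contracts_at P Pi f0 x rate).
Proof.
move=> al ga hf x01 iid hv mn moo hQ.
have [al0 _] := andP al; have [ga0 _] := andP ga.
have [C C0 tail] := sgpr_tail_le al ga hf x01.
have interior := interior_design_near x01.
have mpos : \forall n \near \oo, (0 < m n)%N by exact: (moo _ (nbhs_infty_gt 0)).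
pose r (m' : nat -> nat) n := smooth_rate alpha gamma n + bias_rate alpha gamma n (m' n)
  + spread_rate gamma n (m' n) : R.
have r_gt0 m' n : (0 < n)%N -> 0 < r m' n.
  move=> n0; rewrite /r -addrA; apply: ltr_wpDr; last exact: smooth_rate_gt0.
  by apply: addr_ge0; [exact: bias_rate_ge0 | exact: spread_rate_ge0].
(* The number of inducing variables is left free, to be taken as [m n] for the SGPR and as [n] for
   the full posterior. *)
have tail_near m' (Q' : forall n : nat, Omega n -> probability (path_space R) R) :
    (\forall n \near \oo, (0 < m' n)%N) ->
    (forall (n : nat) (w : Omega n), is_sgpr gamma (m' n) (@mu n) (@v n)
       (observations f0 (fun i : 'I_n => eps n i w)) (Q' n w)) ->
    \forall n \near \oo, forall t, 0 < t ->
    (\int[P n]_w Q' n w [set f : path_space R | (t < `|f x - f0 x|)%R] <=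
     (C * r m' n ^+ 2 / t ^+ 2)%:E)%E.
  move=> m'pos hQ'; near=> n.
  have [n0 xN1 xNn] : [/\ (0 < n)%N, 1 <= x * (n%:R + 2^-1) & x * (n%:R + 2^-1) < n%:R]
    by near: n.
  have m0 : (0 < m' n)%N by near: n.
  by move=> t t0; apply: tail (m0) xN1 xNn (iid n) (hv n) (hQ' n) t0.
split.
  apply: (@contracts_at_tail R d Omega P Q f0 x C (r m) (r m) C0 _ (tail_near m Q mpos hQ)).
  near=> n; have n0 : (0 < n)%N by near: n; exact: nbhs_infty_gt.
  have rn := r_gt0 m n n0; rewrite rn (ltW rn) ler_peMl ?ltW//.
  by rewrite ltr1n.
move=> mbig; set E := 1 / _ * _ in mbig.
(* The growth condition enters through this eventual inequality, which passes to any larger number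
   of inducing variables. *)
have mlarge : \forall n \near \oo, n%:R `^ E / (m n)%:R <= 1 :> R.
  have /cvgr_le/(_ _ ltr01) := mbig; exact.
move=> rate.
have smooth_contracts m' (Q' : forall n : nat, Omega n -> probability (path_space R) R) :
    (forall n, (m n <= m' n)%N) ->
    (forall (n : nat) (w : Omega n), is_sgpr gamma (m' n) (@mu n) (@v n)
       (observations f0 (fun i : 'I_n => eps n i w)) (Q' n w)) ->
    contracts_at P Q' f0 x rate.
  move=> mm' hQ'.
  have m'pos : \forall n \near \oo, (0 < m' n)%N.
    by apply: filterS mpos => n m0; exact: leq_trans (mm' n).
  apply: (@contracts_at_tail R d Omega P Q' f0 x C (r m') rate C0 _
    (tail_near m' Q' m'pos hQ')).
  near=> n; have n0 : (0 < n)%N by near: n; exact: nbhs_infty_gt.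
  have m0 : (0 < m n)%N by near: n.
  split; last exact: smooth_rate_gt0.
  rewrite ltW ?r_gt0//=; apply: rate_le_smooth => //.
    exact: leq_trans (mm' n).
  apply: (@le_trans _ _ (m n)%:R); last by rewrite ler_nat.
  have : n%:R `^ E / (m n)%:R <= 1 :> R by near: n.
  by rewrite ler_pdivrMr ?ltr0n// [1 * (m n)%:R]mul1r.
split; first exact: (smooth_contracts m Q (fun=> leqnn _) hQ).
move=> Pi hPi.
(* The full posterior is read as an SGPR with [n] inducing variables, and [m n <= n] lets it inherit
   the growth condition. *)
have hPi' (n : nat) (w : Omega n) : is_sgpr gamma n (@mu n) (@v n)
    (observations f0 (fun i : 'I_n => eps n i w)) (Pi n w).
  by have := hPi n w; rewrite /is_full_posterior /is_sgpr (full_weight (hv n)).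
exact: (smooth_contracts (fun n => n) Pi mn hPi').
Unshelve. all: by end_near.
Qed.
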